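(* Let $g:[0,1]\times\mathbb{R}^3\to\mathbb{R}$ be a continuous function, and let $\delta\in\mathbb{R}$, $\delta\neq 1$, and $\eta\in(0,1)$. Assume: (H1) There exist two constants $K_2,K_3\ge 0$ and a function $k_1:[0,1]\to\mathbb{R}$ with $k_1^2\in\mathcal{Z}(\ell)$ for some $\ell\ge 0$ such that $$|g(t,u_1,u_2,u_3)-g(t,v_1,v_2,v_3)|\le k_1(t)|u_1-v_1|+K_2|u_2-v_2|+K_3|u_3-v_3|$$ for all $t\in[0,1]$ and $u_i,v_i\in\mathbb{R}$, $i=1,2,3$, and such that $(2\sqrt{\ell}+K_2)\,C(\delta,\eta)+K_3\le 1$. (H2) There exist two functions $a_1,a_4:[0,1]\to\mathbb{R}$ with $a_1^2\in\mathcal{Z}(m)$ for some $m\ge 0$ and $a_4\in L^2[0,1]$, and two constants $A_2,A_3\ge 0$, such that $(2\sqrt{m}+A_2)\,C(\delta,\eta)+A_3<1$ and $$|g(t,u_1,u_2,u_3)|\le a_1(t)|u_1|+A_2|u_2|+A_3|u_3|+a_4(t)$$ for all $t\in[0,1]$ and $u_i\in\mathbb{R}$, $i=1,2,3$. Then the three-point boundary value problem $$x''(t)-g\big(t,x(t),x'(t),x''(t)\big)=0\ \text{ for a.e. } t\in[0,1],\qquad x(0)=0,\quad x'(1)=\delta x'(\eta),$$ has at least one solution $x\in W^{2,2}[0,1]\subseteq\mathcal{C}^1[0,1]$.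
   Context: $W^{2,2}[0,1]$ is the set of $x:[0,1]\to\mathbb{R}$ such that $x,x'$ are absolutely continuous on $[0,1]$ and $x''\in L^2[0,1]$. For $\ell\ge 0$, $\mathcal{Z}(\ell)$ denotes the set of non-negative functions $h:[0,1]\to\mathbb{R}_+$ that are Lebesgue integrable on each closed interval contained in $(0,1]$ and satisfy $\int_t^1 h(s)\,ds\le \ell/t$ for all $0<t<1$. For $\delta\ne 1$ and $\eta\in(0,1)$, $$F(\delta,\eta)=\frac{1}{2(\delta-1)^2}\left[\delta^2(1-\eta)^2+(\delta^2-2\delta)\eta^2+1\right],$$ and $C(\delta,\eta)=\min\{\sqrt{F(\delta,\eta)},\,2/\pi\}$ if $\delta\le 0$, $C(\delta,\eta)=\sqrt{F(\delta,\eta)}$ if $\delta>0$. *)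

(* Defs.v *)
From mathcomp Require Import all_boot all_order all_algebra.
From mathcomp Require Import all_classical all_reals all_analysis.

Set Implicit Arguments.
Unset Strict Implicit.
Unset Printing Implicit Defensive.

Import Order.TTheory GRing.Theory Num.Theory.
Import numFieldNormedType.Exports.

Local Open Scope classical_set_scope.
Local Open Scope ring_scope.

(* A function on [0, 1] is represented by a total function R -> R; every
   definition below depends only on its values on [0, 1].  "Measurable",
   "integrable" and "almost everywhere" refer to the complete Lebesgue
   measure [completed_lebesgue_measure], since the library's
   [lebesgue_measure] only has the Borel sets as measurable sets. *)

Section unit_interval.
Context {R : realType}.
Implicit Types (f h x : R -> R) (l t : R).

Definition I01 : set R := `[0, 1].

Definition absolutely_continuous01 f : Prop :=
  forall e : R, 0 < e -> exists2 d : R, 0 < d &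
    forall (n : nat) (a b : 'I_n -> R),
      (forall i, [/\ 0 <= a i, a i <= b i & b i <= 1]) ->
      trivIset [set: 'I_n] (fun i => `]a i, b i[%classic) ->
      \sum_(i < n) (b i - a i) < d ->
      \sum_(i < n) `|f (b i) - f (a i)| < e.

(* Difference quotients are restricted to [0, 1], so the derivatives at 0 and
   at 1 are one-sided. *)
Definition diffquot01 f t : set_system R :=
  (f s - f t) / (s - t) @[s --> within I01 t^'].

Definition derivable01 f t : Prop := cvg (diffquot01 f t).

Definition deriv01 f t : R := lim (diffquot01 f t).

Definition L2_01 f : Prop :=
  Lfun (@completed_lebesgue_measure R) 2%:E (f \_ I01).

Definition W22_01 x : Prop :=
  [/\ absolutely_continuous01 x,
      forall t, I01 t -> derivable01 x t,
      absolutely_continuous01 (deriv01 x),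
      {ae @completed_lebesgue_measure R,
        forall t, I01 t -> derivable01 (deriv01 x) t} &
      L2_01 (deriv01 (deriv01 x))].

Definition Zclass l h : Prop :=
  [/\ forall t, I01 t -> 0 <= h t,
      forall a b : R, 0 < a -> a <= b -> b <= 1 ->
        (@completed_lebesgue_measure R).-integrable `[a, b] (EFin \o h) &
      forall t, 0 < t < 1 ->
        (\int[@completed_lebesgue_measure R]_(s in `[t, 1%R]) (h s)%:E
           <= (l / t)%:E)%E].

Definition Fconst (delta eta : R) : R :=
  1 / (2 * (delta - 1) ^+ 2) *
  (delta ^+ 2 * (1 - eta) ^+ 2 + (delta ^+ 2 - 2 * delta) * eta ^+ 2 + 1).

Definition Cconst (delta eta : R) : R :=
  if delta <= 0 then Num.min (Num.sqrt (Fconst delta eta)) (2 / pi)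
  else Num.sqrt (Fconst delta eta).

End unit_interval.

(* Main.v *)
Require Import Defs.
From mathcomp Require Import all_boot all_order all_algebra.
From mathcomp Require Import all_classical all_reals all_analysis.
From mathcomp Require Import measurable_realfun.
From mathcomp Require Import ring lra.

Import Order.TTheory GRing.Theory Num.Theory.
Import numFieldNormedType.Exports.

Local Open Scope classical_set_scope.
Local Open Scope ring_scope.

(** The problem is an equation for v = x''.  The conditions x 0 = 0 and
    x' 1 = delta * x' eta determine x' (the function [slope] of v) and x (its
    integral from 0), which depend linearly on v, and x is a solution as soon as
    v is a fixed point in L2 of the operator that sends v to g(t, x, x', v)
    ([superposition], [fixpoint_solution]).

    Two inequalities between L2 norms over [0, 1] measure this dependence.

    - |x'| <= C |v| ([slope_norm_le]).  The constant sqrt F is the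
      Hilbert-Schmidt norm of the kernel that gives x' from v.  If delta <= 0,
      then x' has a zero in [eta, 1] by the intermediate value theorem, and
      Wirtinger's inequality gives the constant 2 / pi ([wirtinger]).

    - |k x| <= 2 sqrt l |x'| if k ^ 2 is in Z(l) ([weighted_primitive]).  As the
      tail of k ^ 2 is at most l / t, this is a form of Hardy's inequality, which
      is the case l = 1, k t = 1 / t ([weighted_hardy]).

    Wirtinger's and Hardy's inequalities both follow from Schur's test
    ([schur_test]), with the weights cos (pi / 2 * (s - c)) and 1 / sqrt s.
    In this form no boundary term at a singular point has to be discussed.

    Together they show that the Lipschitz condition on g makes the operator
    nonexpansive, and that the growth condition gives |N v| <= q |v| + c with
    q < 1 ([majorant_norm_le]).  In a Hilbert space such a map has a fixed point
    ([nonexpansive_fixpoint]): the contractions N / (1 + e) have fixed points,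
    bounded by c / (1 - q), and expanding squared norms shows that they
    converge as e tends to 0.  The completeness of L2 is [L2_complete].

    Everything is done with Borel functions, to which Tonelli's theorem applies.
    The coefficients in the assumptions are only Lebesgue measurable; they are
    replaced by Borel functions equal to them almost everywhere
    ([borel_modification]). *)

(** * Fixed points of nonexpansive maps in a Hilbert space *)

(** The form is only semidefinite, and the space is a set of vectors: this
    applies directly to square integrable functions, without passing to classes
    modulo null sets. *)
Record pre_hilbert {R : realType} {V : lmodType R} (S : set V)
    (ip : V -> V -> R) : Prop := PreHilbert {
  ph0 : S 0;
  phP : forall a u v, S u -> S v -> S (a *: u + v);
  ipC : forall u v, S u -> S v -> ip u v = ip v u;
  ipP : forall a u v w, S u -> S v -> S w ->
    ip (a *: u + v) w = a * ip u w + ip v w;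
  ip_ge0 : forall u, S u -> 0 <= ip u u }.

Section pre_hilbert_theory.
Context {R : realType} {V : lmodType R} {S : set V} {ip : V -> V -> R}.
Context (H : pre_hilbert S ip).

Definition seminorm (u : V) : R := Num.sqrt (ip u u).

Lemma phD u v : S u -> S v -> S (u + v).
Proof. by move=> Su Sv; rewrite -[u]scale1r; exact: (phP _ _ H). Qed.

Lemma phZ a u : S u -> S (a *: u).
Proof.
by move=> Su; rewrite -[a *: u]addr0; apply: (phP _ _ H) => //; exact: ph0 H.
Qed.

Lemma phB u v : S u -> S v -> S (u - v).
Proof.
by move=> Su Sv; rewrite addrC -scaleN1r; exact: (phP _ _ H).
Qed.

Lemma ipZl a u w : S u -> S w -> ip (a *: u) w = a * ip u w.
Proof.
move=> Su Sw; have S0 := ph0 _ _ H.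
have ip0 : ip 0 w = 0.
  have := ipP _ _ H 1 0 0 w S0 S0 Sw; rewrite scale1r addr0 mul1r.
  by move/eqP; rewrite -subr_eq subrr eq_sym => /eqP.
by have := ipP _ _ H a u 0 w Su S0 Sw; rewrite addr0 ip0 addr0.
Qed.

Lemma ipDl u v w : S u -> S v -> S w -> ip (u + v) w = ip u w + ip v w.
Proof.
by move=> Su Sv Sw; have := ipP _ _ H 1 u v w Su Sv Sw; rewrite scale1r mul1r.
Qed.

Lemma ipBl u v w : S u -> S v -> S w -> ip (u - v) w = ip u w - ip v w.
Proof.
move=> Su Sv Sw; rewrite addrC -scaleN1r (ipP _ _ H)// mulN1r.
by rewrite addrC.
Qed.

Lemma ip_sqrB a b u v : S u -> S v -> ip (a *: u - b *: v) (a *: u - b *: v) =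
  a ^+ 2 * ip u u - 2 * (a * b) * ip u v + b ^+ 2 * ip v v.
Proof.
move=> Su Sv; have Sau := phZ a _ Su; have Sbv := phZ b _ Sv.
have Sd := phB _ _ Sau Sbv.
rewrite ipBl// !ipZl// (ipC _ _ H u)// (ipC _ _ H v)// !ipBl// !ipZl//.
rewrite (ipC _ _ H v u)//; ring.
Qed.

Lemma seminorm_ge0 u : 0 <= seminorm u. Proof. exact: sqrtr_ge0. Qed.

Lemma seminorm_sqr u : S u -> seminorm u ^+ 2 = ip u u.
Proof. by move=> Su; rewrite sqr_sqrtr// (ip_ge0 _ _ H). Qed.

Lemma ip_cauchy_schwarz u v : S u -> S v -> ip u v <= seminorm u * seminorm v.
Proof.
move=> Su Sv.
have pos t : 0 <= ip u u - 2 * t * ip u v + t ^+ 2 * ip v v.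
  have := ip_sqrB 1 t u v Su Sv; rewrite expr1n !mul1r => <-.
  by apply: (ip_ge0 _ _ H); apply: phB; exact: phZ.
have [A0 B0] : 0 <= ip u u /\ 0 <= ip v v by split; apply: (ip_ge0 _ _ H).
have [X0|X0] := lerP (ip u v) 0.
  by rewrite (le_trans X0)// mulr_ge0// seminorm_ge0.
rewrite -(@ler_pXn2r _ 2) ?nnegrE ?mulr_ge0 ?seminorm_ge0//; last exact: ltW.
rewrite exprMn !seminorm_sqr//.
move: (ip u u) (ip v v) (ip u v) pos A0 B0 X0 => A B X pos A0 B0 X0.
move: B0; rewrite le_eqVlt => /orP[/eqP B0|B0].
  have := pos ((A + 1) / (2 * X)); rewrite -B0 mulr0 addr0.
  rewrite (_ : 2 * _ * _ = A + 1); last by field; rewrite gt_eqF.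
  lra.
have := pos (X / B); rewrite (_ : _ + _ = (A * B - X ^+ 2) / B); last first.
  by field; rewrite gt_eqF.
by rewrite pmulr_lge0 ?invr_gt0// subr_ge0.
Qed.

Lemma seminormD u v : S u -> S v -> seminorm (u + v) <= seminorm u + seminorm v.
Proof.
move=> Su Sv.
rewrite -(@ler_pXn2r _ 2) ?nnegrE ?addr_ge0 ?seminorm_ge0//.
rewrite sqrrD !seminorm_sqr//; last exact: phD.
have Suv := phD _ _ Su Sv.
rewrite ipDl// (ipC _ _ H u)// (ipC _ _ H v)// !ipDl// (ipC _ _ H v u)//.
have := ip_cauchy_schwarz u v Su Sv; rewrite -mulr_natl; lra.
Qed.

Lemma seminormZ a u : S u -> seminorm (a *: u) = `|a| * seminorm u.
Proof.
move=> Su; have Sau := phZ a _ Su.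
rewrite /seminorm ipZl// (ipC _ _ H)// ipZl// mulrA -expr2.
by rewrite sqrtrM ?sqr_ge0// sqrtr_sqr.
Qed.

Lemma seminormN u : S u -> seminorm (- u) = seminorm u.
Proof. by move=> Su; rewrite -scaleN1r seminormZ// normrN1 mul1r. Qed.

Lemma seminormBC u v : S u -> S v -> seminorm (u - v) = seminorm (v - u).
Proof. by move=> Su Sv; rewrite -opprB seminormN//; exact: phB. Qed.

Lemma seminorm_dist w u v : S u -> S v -> S w ->
  seminorm (u - v) <= seminorm (u - w) + seminorm (w - v).
Proof.
move=> Su Sv Sw; have -> : u - v = (u - w) + (w - v) by rewrite addrA subrK.
by apply: seminormD; exact: phB.
Qed.

Lemma seminorm0 : seminorm 0 = 0.
Proof.
rewrite -(scale0r (0 : V)) seminormZ ?normr0 ?mul0r//; exact: (ph0 _ _ H).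
Qed.

Definition cauchy_in (u : nat -> V) :=
  forall e : R, 0 < e -> exists K, forall m n, (K <= m)%N -> (K <= n)%N ->
    seminorm (u m - u n) < e.

Definition tends_to (u : nat -> V) (l : V) :=
  forall e : R, 0 < e -> exists K, forall n, (K <= n)%N ->
    seminorm (u n - l) < e.

Definition complete_on := forall u : nat -> V, (forall n, S (u n)) ->
  cauchy_in u -> exists2 l, S l & tends_to u l.

Context (complS : complete_on).

(** The defect of l is at most that of u n plus (k + 1) times the distance from
    u n to l. *)
Lemma approx_fixpoint (N : V -> V) (SN : forall u, S u -> S (N u))
    (k : R) (u : nat -> V) (l : V) : 0 <= k ->
  (forall u v, S u -> S v -> seminorm (N u - N v) <= k * seminorm (u - v)) ->
  (forall n, S (u n)) -> S l -> tends_to u l ->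
  (forall e : R, 0 < e -> exists K, forall n, (K <= n)%N ->
    seminorm (N (u n) - u n) < e) ->
  seminorm (N l - l) = 0.
Proof.
move=> k0 lipN Su Sl ul approx; apply/eqP; rewrite eq_le seminorm_ge0 andbT.
apply/ler_addgt0Pl => e e0; rewrite addr0.
have d0 : 0 < e / (k + 2) by rewrite divr_gt0// ltr_wpDl.
have [K1 h1] := ul _ d0; have [K2 h2] := approx _ d0.
set n := maxn K1 K2.
have {}h1 := h1 n (leq_maxl _ _); have {}h2 := h2 n (leq_maxr _ _).
have t1 := seminorm_dist (N (u n)) (N l) l (SN _ Sl) Sl (SN _ (Su n)).
have t2 := seminorm_dist (u n) (N (u n)) l (SN _ (Su n)) Sl (Su n).
have t3 := lipN l (u n) Sl (Su n); rewrite (seminormBC l)// in t3.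
have : k * seminorm (u n - l) <= k * (e / (k + 2)) by rewrite ler_wpM2l// ltW.
have eE : e = (k + 2) * (e / (k + 2)).
  by rewrite mulrC divfK// gt_eqF// ltr_wpDl.
by move=> ?; rewrite mulrDl in eE; lra.
Qed.

(** Banach's iteration from 0.  Once the iterates are known to be bounded by D,
    applying the contraction n times gives
    |u (n + p) - u n| <= k ^ n * |u p - u 0| <= k ^ n * D. *)
Lemma contraction_fixpoint (N : V -> V) (SN : forall u, S u -> S (N u))
    (k : R) : 0 <= k -> k < 1 ->
  (forall u v, S u -> S v -> seminorm (N u - N v) <= k * seminorm (u - v)) ->
  exists2 a, S a & seminorm (N a - a) = 0.
Proof.
move=> k0 k1 lipN.
pose u n := iter n N 0; have Su n : S (u n).
  by elim: n => [|n IH]; [exact: (ph0 _ _ H)|exact: SN].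
set d := seminorm (N 0); pose D := d / (1 - k).
have DE : k * D + d = D by rewrite /D; field; rewrite subr_eq0 gt_eqF.
have D0 : 0 <= D by rewrite divr_ge0 ?seminorm_ge0// subr_ge0 ltW.
have ubnd n : seminorm (u n) <= D.
  elim: n => [|n IH]; first by rewrite seminorm0.
  have S0 := ph0 _ _ H.
  have := seminorm_dist (N 0) (u n.+1) 0 (Su _) S0 (SN _ S0).
  rewrite !subr0 => /le_trans; apply; rewrite -DE lerD2r.
  by apply: le_trans (lipN _ _ (Su n) S0) _; rewrite subr0 ler_wpM2l.
have step n p : seminorm (u (n + p)%N - u n) <= k ^+ n * D.
  elim: n => [|n IH]; first by rewrite add0n subr0 expr0 mul1r.
  rewrite addSn; apply: le_trans (lipN _ _ (Su _) (Su _)) _.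
  by rewrite exprS -mulrA ler_wpM2l.
have small (e : R) : 0 < e -> exists K, forall n, (K <= n)%N -> k ^+ n * D < e.
  move=> e0; have /cvgrPdist_lt/(_ (e / (D + 1))) : k ^+ n @[n --> \oo] --> (0 : R).
    by apply: cvg_expr; rewrite ger0_norm.
  rewrite divr_gt0 ?ltr_wpDl// => /(_ isT)[K _ hK]; exists K => n Kn.
  have /= := hK n Kn; rewrite sub0r normrN ger0_norm ?exprn_ge0//.
  rewrite ltr_pdivlMr ?ltr_wpDl// mulrDr mulr1.
  by have := exprn_ge0 n k0; lra.
have uC : cauchy_in u.
  move=> e e0; have [K hK] := small _ e0; exists K => m n.
  wlog mn : m n / (m <= n)%N => [wl Km Kn|Km _].
    have [mn|/ltnW mn] := leqP m n; first exact: wl.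
    by rewrite seminormBC//; exact: wl.
  rewrite seminormBC//; apply: le_lt_trans (hK _ Km).
  by rewrite -(subnKC mn).
have [a Sa ua] := complS u Su uC; exists a => //.
apply: (approx_fixpoint N SN k u) => // e e0; have [K hK] := small _ e0.
exists K => n Kn; apply: le_lt_trans (hK _ Kn).
by have := step n 1%N; rewrite addn1.
Qed.

(** Browder's fixed point theorem, by regularisation: for e > 0 the map
    N / (1 + e) is a contraction.  If a is its fixed point for e and b the one
    for m, with e >= m > 0, then expanding |N a - N b|^2 <= |a - b|^2, where
    N a = (1 + e) a and N b = (1 + m) b, yields
    |a - b|^2 <= (1 + m) |b|^2 - (1 + e) |a|^2, so that (1 + e) |a|^2 increases
    as e decreases; since it is bounded, the fixed points form a Cauchy
    sequence as e tends to 0. *)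
Theorem nonexpansive_fixpoint (N : V -> V) (SN : forall u, S u -> S (N u))
    (q c : R) : q < 1 ->
  (forall u v, S u -> S v -> seminorm (N u - N v) <= seminorm (u - v)) ->
  (forall u, S u -> seminorm (N u) <= q * seminorm u + c) ->
  exists2 a, S a & seminorm (N a - a) = 0.
Proof.
move=> q1 lipN grN.
pose eps n : R := n.+1%:R^-1.
have eps0 n : 0 < eps n by rewrite invr_gt0.
have eps_lt m n : (m < n)%N -> eps n < eps m.
  by move=> mn; rewrite ltf_pV2 ?posrE// ltr_nat.
have regularized n : exists a, S a /\ seminorm (N a - (1 + eps n) *: a) = 0.
  have e0 := eps0 n; have e1 : 0 < 1 + eps n by rewrite addr_gt0.
  have kE : `|(1 + eps n)^-1| = (1 + eps n)^-1 by rewrite gtr0_norm ?invr_gt0.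
  have [||||a Sa aE] := contraction_fixpoint (fun u => (1 + eps n)^-1 *: N u)
    _ (1 + eps n)^-1.
  - by move=> u Su; apply: phZ; exact: SN.
  - by rewrite invr_ge0 ltW.
  - by rewrite invf_lt1// ltrDl.
  - move=> u v Su Sv; rewrite -scalerBr seminormZ ?kE; last first.
      by apply: phB; exact: SN.
    by rewrite ler_wpM2l ?lipN// invr_ge0 ltW.
  exists a; split=> //.
  have -> : N a - (1 + eps n) *: a = (1 + eps n) *: ((1 + eps n)^-1 *: N a - a).
    by rewrite scalerBr scalerA divff ?scale1r// gt_eqF.
  by rewrite seminormZ ?aE ?mulr0//; apply: phB => //; apply: phZ; exact: SN.
have [a /all_and2[Sa aE]] := choice regularized.
pose B := c / (1 - q).
have aB n : seminorm (a n) <= B.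
  have := seminorm_dist (N (a n)) ((1 + eps n) *: a n) 0.
  have Sea : S ((1 + eps n) *: a n) by exact: phZ.
  have SNa := SN _ (Sa n).
  move=> /(_ Sea (ph0 _ _ H) SNa).
  rewrite !subr0 seminormBC// aE add0r seminormZ//.
  rewrite gtr0_norm ?addr_gt0// => /le_trans/(_ (grN _ (Sa n))) h.
  rewrite ler_pdivlMr ?subr_gt0//.
  by have := mulr_ge0 (ltW (eps0 n)) (seminorm_ge0 (a n)); lra.
pose phi n := (1 + eps n) * seminorm (a n) ^+ 2.
(* The sequence phi n increases and is bounded by 2 * B ^ 2. *)
have dist_phi m n : (m <= n)%N -> seminorm (a m - a n) ^+ 2 <= phi n - phi m.
  rewrite leq_eqVlt => /orP[/eqP->|mn]; first by rewrite !subrr seminorm0 expr0n.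
  have [em en enm] := And3 (eps0 m) (eps0 n) (eps_lt _ _ mn).
  have SNm := SN _ (Sa m); have SNn := SN _ (Sa n).
  have [Sm Sn] := (phZ (1 + eps m) _ (Sa m), phZ (1 + eps n) _ (Sa n)).
  have lin : seminorm ((1 + eps m) *: a m - (1 + eps n) *: a n) <=
      seminorm (a m - a n).
    have t1 := seminorm_dist (N (a m)) _ _ Sm Sn SNm.
    have t2 := seminorm_dist (N (a n)) _ _ SNm Sn SNn.
    rewrite (seminormBC _ _ Sm SNm) !aE in t1 t2.
    by have := lipN _ _ (Sa m) (Sa n); lra.
  have := ip_sqrB 1 1 _ _ (Sa m) (Sa n); rewrite !scale1r !mul1r expr1n !mul1r.
  have := ip_sqrB (1 + eps m) (1 + eps n) _ _ (Sa m) (Sa n).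
  rewrite -!seminorm_sqr//; try (by exact: phB).
  move: lin; rewrite -(@ler_pXn2r _ 2) ?nnegrE ?seminorm_ge0// => + E1 E2.
  rewrite {}E1 E2 /phi.
  have : 0 <= seminorm (a m - a n) ^+ 2 by rewrite sqr_ge0.
  rewrite E2.
  move: (seminorm (a m)) (seminorm (a n)) (ip _ _) (eps m) (eps n) em en enm.
  move=> x y X e f e0 f0 fe D0 h.
  pose D := x ^+ 2 - 2 * X + y ^+ 2.
  pose s := e + f + e * f.
  have s0 : 0 < s by rewrite !addr_gt0// mulr_gt0.
  have key : s * D <= (e - f) * ((1 + f) * y ^+ 2 - (1 + e) * x ^+ 2).
    rewrite /s /D. lra.
  have : (e - f) * D <= s * D.
    rewrite ler_wpM2r//; first by rewrite /D; lra.
    by rewrite /s; have := mulr_gt0 e0 f0; lra.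
  move=> /le_trans/(_ key); rewrite ler_pM2l ?subr_gt0// /D; lra.
have phi_nd : nondecreasing_seq phi.
  apply/nondecreasing_seqP => n; rewrite -subr_ge0.
  exact: le_trans (sqr_ge0 _) (dist_phi _ _ (leqnSn n)).
have B0 : 0 <= B by exact: le_trans (seminorm_ge0 _) (aB 0%N).
have phi_cvg : cvgn phi.
  apply: nondecreasing_is_cvgn => //; exists (2 * B ^+ 2) => _ [n _ <-].
  rewrite /phi ler_pM ?sqr_ge0 ?addr_ge0 ?(ltW (eps0 n))//.
    have : eps n <= 1 by rewrite invf_le1// ler1n.
    lra.
  by rewrite ler_pXn2r ?nnegrE// seminorm_ge0.
have phi_cauchy (e : R) : 0 < e -> exists K, forall n, (K <= n)%N ->
    limn phi - phi n < e.
  move/cvgrPdist_lt: phi_cvg => h /h[K _ hK]; exists K => n Kn.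
  exact: le_lt_trans (ler_norm _) (hK n Kn).
have aC : cauchy_in a.
  move=> e e0; have [K hK] := phi_cauchy _ (exprn_gt0 2 e0); exists K => m n.
  wlog mn : m n / (m <= n)%N => [wl Km Kn|Km _].
    have [mn|/ltnW mn] := leqP m n; first exact: wl.
    by rewrite seminormBC//; exact: wl.
  rewrite -(@ltr_pXn2r _ 2) ?nnegrE ?seminorm_ge0 ?(ltW e0)//.
  apply: le_lt_trans (dist_phi _ _ mn) _; apply: le_lt_trans (hK _ Km).
  by rewrite lerD2r; apply: nondecreasing_cvgn_le.
have [l Sl al] := complS a Sa aC; exists l => //.
apply: (approx_fixpoint N SN 1 a) => //; first by move=> *; rewrite mul1r lipN.
move=> e e0.
have [K _ hK] : \forall n \near \oo, eps n < e / (B + 1).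
  by apply: near_infty_natSinv_lt (PosNum _) => //; rewrite divr_gt0 ?ltr_wpDl.
exists K => n Kn; have /= := hK n Kn; rewrite ltr_pdivlMr ?ltr_wpDl// => he.
have Sea := phZ (1 + eps n) _ (Sa n).
have := seminorm_dist ((1 + eps n) *: a n) _ _ (SN _ (Sa n)) (Sa n) Sea.
rewrite aE add0r => /le_lt_trans; apply; apply: le_lt_trans he.
rewrite scalerDl scale1r addrC addKr seminormZ// gtr0_norm//.
by rewrite ler_wpM2l ?(ltW (eps0 n))//; have := aB n; lra.
Qed.

End pre_hilbert_theory.

(** * L2 functions on the unit interval *)

Section l2_space.
Context {R : realType}.
Notation mu := (@lebesgue_measure R).


(** Functions are extended by 0 outside [0, 1], and all integrals are taken over
    the line. *)
Definition sq_int01 (v : R -> R) :=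
  [/\ measurable_fun [set: R] v, (forall t, ~ I01 t -> v t = 0) &
      (\int[mu]_t (v t ^+ 2)%:E < +oo)%E].

Definition L2 : set (R -> R^o) := [set v | sq_int01 v].

Definition L2ip (v w : R -> R^o) : R := \int[mu]_t ((v t : R) * w t).


Notation norm2 := (@seminorm R (R -> R^o) L2ip).

Lemma measurable_I01 : measurable (I01 : set R).
Proof. exact: measurable_itv. Qed.

Lemma lebesgue_I01 : mu (I01 : set R) = 1%E.
Proof. by rewrite /I01 lebesgue_measure_itv/= lte_fin ltr01/= sube0. Qed.

Lemma lebesgue_aeS (P Q : R -> Prop) : (forall t, P t -> Q t) ->
  {ae mu, forall t, P t} -> {ae mu, forall t, Q t}.
Proof.
by move=> PQ; apply: filterS => //; exact: (ae_filter_ringOfSetsType mu).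
Qed.

Lemma lebesgue_aeI (P Q : R -> Prop) :
  {ae mu, forall t, P t} -> {ae mu, forall t, Q t} ->
  {ae mu, forall t, P t /\ Q t}.
Proof.
move=> aP aQ; have F := ae_filter_ringOfSetsType mu.
exact: (@filterI _ _ F).
Qed.

Lemma ge0_le_integralT (f g : R -> R) : measurable_fun [set: R] f ->
  measurable_fun [set: R] g -> (forall t, 0 <= f t <= g t) ->
  (\int[mu]_t (f t)%:E <= \int[mu]_t (g t)%:E)%E.
Proof.
move=> mf mg fg; apply: ge0_le_integral => //=.
- by move=> t _; rewrite lee_fin; have /andP[] := fg t.
- exact/measurable_EFinP.
- exact/measurable_EFinP.
- by move=> t _; rewrite lee_fin; have /andP[] := fg t.
Qed.

Lemma integral_sqr_ae_le (v w : R -> R) : measurable_fun [set: R] v ->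
  measurable_fun [set: R] w -> {ae mu, forall t, `|v t| <= `|w t|} ->
  (\int[mu]_t (v t ^+ 2)%:E <= \int[mu]_t (w t ^+ 2)%:E)%E.
Proof.
move=> mv mw vw; apply: ae_ge0_le_integral => //.
- by move=> t _; rewrite lee_fin sqr_ge0.
- by apply/measurable_EFinP; exact: measurable_funX.
- by move=> t _; rewrite lee_fin sqr_ge0.
- by apply/measurable_EFinP; exact: measurable_funX.
- apply: lebesgue_aeS vw => t vwt _.
  rewrite lee_fin -[leLHS]real_normK ?num_real//.
  by rewrite -[leRHS]real_normK ?num_real// ler_pXn2r ?nnegrE.
Qed.

Lemma sq_int01_ae_le (v w : R -> R) : measurable_fun [set: R] v ->
  (forall t, ~ I01 t -> v t = 0) -> sq_int01 w ->
  {ae mu, forall t, `|v t| <= `|w t|} -> sq_int01 v.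
Proof.
move=> mv v0 [mw _ wfin] vw; split=> //; apply: le_lt_trans wfin.
exact: integral_sqr_ae_le.
Qed.

Lemma sq_int01_le (v w : R -> R) : measurable_fun [set: R] v ->
  (forall t, `|v t| <= `|w t|) -> sq_int01 w -> sq_int01 v.
Proof.
move=> mv vw sw; apply: (sq_int01_ae_le _ w) => //; last exact: aeW.
by case: sw => _ w0 _ t /w0 wt; have := vw t; rewrite wt normr0 normr_le0 => /eqP.
Qed.

Lemma sq_int01Z (a : R) (v : R -> R) : sq_int01 v ->
  sq_int01 (fun t => a * v t).
Proof.
move=> [mv v0 vfin]; split.
- exact: measurable_funM.
- by move=> t /v0 ->; rewrite mulr0.
- under eq_integral do rewrite exprMn EFinM.
  rewrite ge0_integralZl_EFin ?sqr_ge0//.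
  + by rewrite lte_mul_pinfty// lee_fin sqr_ge0.
  + by move=> t _; rewrite lee_fin sqr_ge0.
  + by apply/measurable_EFinP; exact: measurable_funX.
Qed.

Lemma sq_int01D (v w : R -> R) : sq_int01 v -> sq_int01 w ->
  sq_int01 (v \+ w).
Proof.
move=> [mv v0 vfin] [mw w0 wfin]; split.
- exact: measurable_funD.
- by move=> t /[dup]/v0 + /w0 /= => -> ->; rewrite addr0.
- have mv2 : measurable_fun [set: R] (fun t => 2 * v t ^+ 2).
    by apply: measurable_funM => //; exact: measurable_funX.
  have mw2 : measurable_fun [set: R] (fun t => 2 * w t ^+ 2).
    by apply: measurable_funM => //; exact: measurable_funX.
  apply: (@le_lt_trans _ _ (\int[mu]_t (2 * v t ^+ 2 + 2 * w t ^+ 2)%:E)%E).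
    apply: ge0_le_integralT.
    + by apply: measurable_funX; exact: measurable_funD.
    + exact: measurable_funD.
    + move=> t; rewrite sqr_ge0/=.
      by have := sqr_ge0 (v t - w t); rewrite sqrrB sqrrD; lra.
  under eq_integral do rewrite EFinD.
  rewrite ge0_integralD//=; last 4 first.
  + by move=> t _; rewrite lee_fin mulr_ge0// sqr_ge0.
  + exact/measurable_EFinP.
  + by move=> t _; rewrite lee_fin mulr_ge0// sqr_ge0.
  + exact/measurable_EFinP.
  under eq_integral do rewrite EFinM.
  under [X in (_ + X)%E]eq_integral do rewrite EFinM.
  rewrite !ge0_integralZl_EFin//; first last.
  + by apply/measurable_EFinP; exact: measurable_funX.
  + by move=> t _; rewrite lee_fin sqr_ge0.
  + by apply/measurable_EFinP; exact: measurable_funX.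
  + by move=> t _; rewrite lee_fin sqr_ge0.
  by rewrite lte_add_pinfty// lte_mul_pinfty// lee_fin.
Qed.

Lemma sq_int01B (v w : R -> R) : sq_int01 v -> sq_int01 w ->
  sq_int01 (v \- w).
Proof.
move=> sv sw; have := sq_int01D _ _ sv (sq_int01Z (-1) _ sw).
by congr sq_int01; apply/funext => t /=; rewrite mulN1r.
Qed.

Lemma sq_int01_indic : sq_int01 (\1_I01 : R -> R).
Proof.
split; first by apply: measurable_indic; exact: measurable_I01.
  by move=> t It; rewrite indicE memNset.
under eq_integral do rewrite indicE -natrX expnS expn1 mulnb andbb -indicE.
rewrite integral_indic//; last exact: measurable_I01.
by rewrite setIT [ltLHS]lebesgue_I01 ltry.
Qed.

Lemma sq_int01_integrableM (v w : R -> R) : sq_int01 v -> sq_int01 w ->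
  mu.-integrable setT (EFin \o (v \* w)).
Proof.
move=> sv sw; have [mv _ vfin] := sv; have [mw _ wfin] := sw.
have [mvw _ fin] := sq_int01D _ _ sv sw.
have mv2 : measurable_fun [set: R] (EFin \o (fun t => v t ^+ 2)).
  by apply/measurable_EFinP; exact: measurable_funX.
have mw2 : measurable_fun [set: R] (EFin \o (fun t => w t ^+ 2)).
  by apply/measurable_EFinP; exact: measurable_funX.
apply: (@le_integrable _ _ _ mu _ measurableT _
    (EFin \o ((fun t => v t ^+ 2) \+ (fun t => w t ^+ 2)))) => //.
- by apply/measurable_EFinP; exact: measurable_funM.
- move=> t _; rewrite /= lee_fin [leRHS]ger0_norm ?addr_ge0 ?sqr_ge0// normrM.
  rewrite -[X in X + _]real_normK ?num_real// -[X in _ + X]real_normK ?num_real//.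
  have [v2 w2] := (sqr_ge0 `|v t|, sqr_ge0 `|w t|).
  by have := sqr_ge0 (`|v t| - `|w t|); rewrite sqrrB; lra.
- apply: (@integrableD _ _ _ mu _ measurableT
      (EFin \o (fun t => v t ^+ 2)%R) (EFin \o (fun t => w t ^+ 2)%R)) => //;
    apply/integrableP; split=> //.
  + by under eq_integral do rewrite gee0_abs ?lee_fin ?sqr_ge0//.
  + by under eq_integral do rewrite gee0_abs ?lee_fin ?sqr_ge0//.
Qed.

Lemma L2_pre_hilbert : pre_hilbert L2 L2ip.
Proof.
split.
- split; [exact: measurable_cst|by []|].
  by rewrite integral0_eq// => t _; rewrite expr0n.
- by move=> a u v Su Sv; apply: sq_int01D => //; exact: sq_int01Z.
- by move=> u v _ _; apply: eq_Rintegral => t _; rewrite mulrC.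
- move=> a u v w Su Sv Sw.
  rewrite /L2ip -RintegralZl//; last exact: sq_int01_integrableM.
  rewrite -RintegralD//.
  + apply: eq_Rintegral => t _.
    by rewrite -[(a *: u + v) t]/(a * u t + v t) mulrDl mulrA.
  + rewrite [EFin \o _](_ : _ = fun t => (a%:E * (EFin \o (u \* w)%R) t)%E)//.
    by apply: integrableZl => //; exact: sq_int01_integrableM.
  + exact: sq_int01_integrableM.
- by move=> u _; apply: Rintegral_ge0 => t _; rewrite -expr2 sqr_ge0.
Qed.

Lemma norm2_sqr (v : R -> R) : sq_int01 v ->
  (norm2 v ^+ 2)%:E = (\int[mu]_t (v t ^+ 2)%:E)%E.
Proof.
move=> sv; rewrite (seminorm_sqr L2_pre_hilbert)// /L2ip /Rintegral fineK.
  by apply: eq_integral => t _; rewrite expr2.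
by apply: integrable_fin_num => //; exact: sq_int01_integrableM.
Qed.

Lemma norm2_le (v : R -> R) (c : R) : 0 <= c -> sq_int01 v ->
  (\int[mu]_t (v t ^+ 2)%:E <= (c ^+ 2)%:E)%E -> norm2 v <= c.
Proof.
move=> c0 sv; rewrite -norm2_sqr// lee_fin ler_pXn2r// nnegrE//.
exact: seminorm_ge0.
Qed.

Lemma norm2_ae_le (v w : R -> R) : sq_int01 v -> sq_int01 w ->
  {ae mu, forall t, `|v t| <= `|w t|} -> norm2 v <= norm2 w.
Proof.
move=> sv sw vw; apply: norm2_le => //; first exact: seminorm_ge0.
have [[mv _ _] [mw _ _]] := (sv, sw).
by rewrite norm2_sqr//; exact: integral_sqr_ae_le.
Qed.

Lemma sq_int01_norm (v : R -> R) : sq_int01 v -> sq_int01 (fun t => `|v t|).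
Proof.
move=> sv; apply: (sq_int01_le _ v) => //.
  by apply: measurableT_comp => //; case: sv.
by move=> t; rewrite normr_id.
Qed.

Lemma norm2_norm (v : R -> R) : norm2 (fun t => `|v t|) = norm2 v.
Proof.
congr Num.sqrt; apply: eq_Rintegral => t _.
by rewrite -!expr2 real_normK// num_real.
Qed.

Lemma norm2_indic : norm2 (\1_I01 : R -> R) = 1.
Proof.
rewrite -[RHS]sqrtr1; congr Num.sqrt; rewrite /L2ip /Rintegral.
under eq_integral do rewrite indicE -natrM mulnb andbb -indicE.
rewrite integral_indic//; last exact: measurable_I01.
by rewrite setIT [X in fine X]lebesgue_I01.
Qed.

Lemma sq_int01_integrable (v : R -> R) : sq_int01 v ->
  mu.-integrable setT (EFin \o v).
Proof.
move=> sv; have := sq_int01_integrableM _ _ sv sq_int01_indic.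
congr (mu.-integrable _ _); apply/funext => t /=; congr EFin.
have [It|It] := pselect (I01 t); first by rewrite indicE mem_set ?mulr1.
by rewrite indicE memNset// mulr0; case: sv => _ ->.
Qed.

(** The Cauchy-Schwarz inequality against the indicator of [0, 1], which has
    norm 1. *)
Lemma integral_norm_le_norm2 (v : R -> R) : sq_int01 v ->
  (\int[mu]_t `|v t|%:E <= (norm2 v)%:E)%E.
Proof.
move=> sv; have sn := sq_int01_norm _ sv.
have -> : (\int[mu]_t `|v t|%:E)%E = (L2ip (fun t => `|v t|) \1_I01)%:E.
  rewrite /L2ip /Rintegral fineK.
    apply: eq_integral => t _; congr EFin.
    have [It|It] := pselect (I01 t); first by rewrite indicE mem_set ?mulr1.
    by rewrite indicE memNset// mulr0; case: sn => _ ->.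
  apply: integrable_fin_num => //; apply: sq_int01_integrableM => //.
  exact: sq_int01_indic.
rewrite lee_fin.
apply: le_trans (ip_cauchy_schwarz L2_pre_hilbert _ _ sn sq_int01_indic) _.
by rewrite norm2_norm norm2_indic mulr1.
Qed.

(** Riesz-Fischer: a subsequence along which consecutive distances are at most
    2^-k converges almost everywhere, because the sum of its absolute
    increments is integrable; Fatou's lemma then bounds the distance of the
    sequence to the pointwise limit. *)
Lemma L2_complete : @complete_on R (R -> R^o) L2 L2ip.
Proof.
move=> u Su uC.
have e0 k : (0 : R) < 2^-1 ^+ k by rewrite exprn_gt0// invr_gt0.
have [K hK] := choice (fun k => uC _ (e0 k)).
pose p k := \max_(i < k.+1) K i.
have Kp k j : (k <= j)%N -> (K k <= p j)%N.
  move=> kj; rewrite /p; have kj' : (k < j.+1)%N by [].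
  exact: (leq_bigmax (Ordinal kj')).
pose w k : R -> R := u (p k).
have Sw k : sq_int01 (w k) by exact: Su.
pose d k : R -> R := w k.+1 \- w k.
have Sd k : sq_int01 (d k) by by apply: sq_int01B; exact: Su.
have dle k : norm2 (d k) <= 2^-1 ^+ k.
  by apply/ltW/hK; exact: Kp.
have mabsd k : measurable_fun [set: R] (fun t => `|d k t|).
  by case: (sq_int01_norm _ (Sd k)).
have absd_int : mu.-integrable setT
    (fun t => \sum_(0 <= k <oo) `|d k t|%:E)%E.
  apply/integrableP; split.
    apply: ge0_emeasurable_sum => //.
    by move=> k _; have /measurable_EFinP := mabsd k.
  under eq_integral do rewrite gee0_abs ?nneseries_ge0//.
  rewrite integral_nneseries//; last first.
    by move=> k; have /measurable_EFinP := mabsd k.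
  apply: (@le_lt_trans _ _ (\sum_(0 <= k <oo) (2^-1 ^+ k)%:E)%E).
    apply: lee_nneseries => [k _|k _]; first by rewrite integral_ge0.
    by apply: le_trans (integral_norm_le_norm2 _ (Sd k)) _; rewrite lee_fin.
  apply: (@le_lt_trans _ _ (1 / (1 - 2^-1) : R)%:E); last exact: ltry.
  apply: lime_le; first by apply: is_cvg_nneseries => k _ _; rewrite lee_fin ltW.
  apply: nearW => n; rewrite sumEFin lee_fin.
  have := @geometric_le_lim R n 1 2^-1 ler01; rewrite seriesEnat/=.
  under eq_bigr do rewrite mul1r.
  by apply; rewrite ?invr_gt0// gtr0_norm ?invr_gt0// invf_lt1 ?ltr1n.
have w_cvg : {ae mu, forall t, cvgn (w ^~ t)}.
  have := integrable_ae measurableT absd_int; apply: lebesgue_aeS => t /(_ I) fin.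
  have /normed_cvg dcvg : cvgn [normed series (d ^~ t)].
    apply: nondecreasing_is_cvgn.
      by apply: nondecreasing_series => k _ _; exact: normr_ge0.
    exists (fine (\sum_(0 <= k <oo) `|d k t|%:E)%E) => _ [n _ <-].
    rewrite -lee_fin fineK// /series /= -sumEFin.
    by apply: nneseries_lim_ge => k _ _; rewrite lee_fin.
  have -> : w ^~ t = (fun n => w 0%N t + series (d ^~ t) n).
    apply/funext => n; rewrite seriesEnat/= telescope_sumr// addrC subrK//.
  by apply: is_cvgD => //; exact: is_cvg_cst.
pose f (t : R) : R := fine (limn_esup (fun k => (w k t)%:E)).
have mf : measurable_fun [set: R] f.
  apply: measurableT_comp => //.
  apply: measurable_fun_limn_esup => k.
  by apply/measurable_EFinP; case: (Sw k).
have w_f : {ae mu, forall t, w k t @[k --> \oo] --> f t}.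
  apply: lebesgue_aeS w_cvg => t wt.
  have wt' : (w k t)%:E @[k --> \oo] --> (limn (w ^~ t))%:E.
    by apply: cvg_EFin; [exact: nearW|exact: wt].
  by rewrite /f (cvg_limn_einf_sup wt').2.
have f0 t : ~ I01 t -> f t = 0.
  move=> It; rewrite /f (_ : (fun k => _) = cst 0%E).
    by rewrite (cvg_limn_einf_sup (cvg_cst (0%E : \bar R))).2.
  by apply/funext => k /=; case: (Sw k) => _ ->.
have dist_le n k : (K k <= n)%N ->
    (\int[mu]_t ((u n t - f t) ^+ 2)%:E <= ((2^-1 ^+ k) ^+ 2)%:E)%E.
  move=> Kn; have [mu_ _ _] := Su n.
  pose h j t := ((u n t - w j t) ^+ 2)%:E.
  have mh j : measurable_fun [set: R] (h j).
    apply/measurable_EFinP; apply: measurable_funX.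
    by apply: measurable_funB => //; case: (Sw j).
  have h0 j t : [set: R] t -> (0 <= h j t)%E by rewrite lee_fin sqr_ge0.
  apply: (@le_trans _ _ (\int[mu]_t limn_einf (h ^~ t))%E).
    apply: ae_ge0_le_integral => //.
    - by move=> t _; rewrite lee_fin sqr_ge0.
    - apply/measurable_EFinP; apply: measurable_funX.
      exact: measurable_funB.
    - move=> t _; rewrite limn_einf_lim; apply: lime_ge.
        exact: is_cvg_einfs.
      by apply: nearW => m; apply/ereal_infP => _ [j _ <-]; exact: h0.
    - rewrite (_ : (fun t => _) = -%E \o
          (fun t => limn_esup ((fun j t => - h j t)%E ^~ t))); last first.
        by apply/funext => t; rewrite /= -[LHS]oppeK -limn_esupN.
      apply: measurableT_comp => //; apply: measurable_fun_limn_esup => j.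
      by apply: (@measurableT_comp _ _ _ _ _ _ -%E) => //; exact: mh.
    - apply: lebesgue_aeS w_f => t wt _.
      have ht : h ^~ t @ \oo --> ((u n t - f t) ^+ 2)%:E.
        apply: cvg_EFin; first exact: nearW.
        rewrite (_ : fine \o _ = (fun j => (u n t - w j t) * (u n t - w j t)))//.
        by rewrite expr2; apply: cvgM; apply: cvgB => //; exact: cvg_cst.
      by rewrite (cvg_limn_einf_sup ht).1.
  apply: le_trans (fatou mu measurableT mh h0) _.
  rewrite limn_einf_lim; apply: lime_le; first exact: is_cvg_einfs.
  apply: nearW => m; apply: (@le_trans _ _ (\int[mu]_t h (maxn m k) t)%E).
    by apply: ereal_inf_lbound; exists (maxn m k) => //=; exact: leq_maxl.
  have Sd' : sq_int01 (fun t => u n t - w (maxn m k) t).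
    by apply: sq_int01B; exact: Su.
  rewrite -norm2_sqr// lee_fin ler_pXn2r ?nnegrE ?seminorm_ge0 ?ltW//.
  by apply: hK => //; apply: Kp; exact: leq_maxr.
have Sf : sq_int01 f.
  have Sn : sq_int01 (fun t => u (K 0%N) t - f t).
    split.
    - by apply: measurable_funB => //; case: (Su (K 0%N)).
    - by move=> t It; rewrite f0//; case: (Su (K 0%N)) => _ ->//; rewrite subr0.
    - exact: le_lt_trans (dist_le _ _ (leqnn _)) (ltry _).
  have := sq_int01B _ _ (Su (K 0%N)) Sn; congr sq_int01; apply/funext => t.
  by rewrite /= opprB addrC subrK.
exists f => // e e_gt0.
have [k ke] : exists k, 2^-1 ^+ k < e.
  have /cvgrPdist_lt/(_ e e_gt0)[k _ hk] : 2^-1 ^+ k @[k --> \oo] --> (0 : R).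
    by apply: cvg_expr; rewrite gtr0_norm ?invr_gt0// invf_lt1 ?ltr1n.
  exists k; have /= := hk k (leqnn k).
  by rewrite sub0r normrN gtr0_norm.
exists (K k) => n Kn; apply: le_lt_trans ke.
apply: norm2_le; first exact/ltW/e0.
  by apply: sq_int01B => //; exact: Su.
exact: dist_le.
Qed.

End l2_space.

(** * Schur's test *)

Section schur.
Context {R : realType}.
Notation mu := (@lebesgue_measure R).
Notation norm2 := (@seminorm R (R -> R^o) L2ip).

Lemma integral_cauchy_schwarz (f g : R -> R) : measurable_fun [set: R] f ->
  measurable_fun [set: R] g ->
  ((\int[mu]_t `|f t * g t|%:E) * (\int[mu]_t `|f t * g t|%:E) <=
   (\int[mu]_t (f t ^+ 2)%:E) * (\int[mu]_t (g t ^+ 2)%:E))%E.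
Proof.
move=> mf mg.
have N2 (u : R -> R) : Lnorm mu 2%:E (EFin \o u) =
    sqrte (\int[mu]_t (u t ^+ 2)%:E)%E.
  rewrite unlock /= poweR12_sqrt.
    congr sqrte; apply: eq_integral => t _ /=.
    by rewrite -[LHS]/((`|u t| `^ 2%:R)%R%:E) powR_mulrn// real_normK// num_real.
  by apply: integral_ge0 => t _; rewrite lee_fin powR_ge0.
have := hoelder mu mf mg (ltr0n R 2) (ltr0n R 2).
have half : 2^-1 + 2^-1 = 1 :> R by lra.
move=> /(_ half); rewrite Lnorm1 !N2 => I_le.
have I0 : (0 <= \int[mu]_t `|f t * g t|%:E)%E by exact: integral_ge0.
apply: le_trans (lee_pmul I0 I0 I_le I_le) _.
rewrite muleACA -!expe2 !sqr_sqrte// integral_ge0// => t _.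
- by rewrite lee_fin sqr_ge0.
- by rewrite lee_fin sqr_ge0.
Qed.

Lemma section_integral_ge0 (E : set (R * R)) (v : R -> R) (t : R) :
  (0 <= \int[mu]_s (\1_E (t, s) * `|v s|)%:E)%E.
Proof.
by apply: integral_ge0 => s _; rewrite lee_fin mulr_ge0// indicE.
Qed.

Lemma measurable_section_integral (E : set (R * R)) (v : R -> R) :
  measurable E -> measurable_fun [set: R] v ->
  measurable_fun [set: R] (fun t => \int[mu]_s (\1_E (t, s) * `|v s|)%:E)%E.
Proof.
move=> mE mv; pose G (z : R * R) := (\1_E z * `|v z.2|)%:E.
have mG : measurable_fun [set: R * R] G.
  apply/measurable_EFinP; apply: measurable_funM; first exact: measurable_indic.
  apply: measurableT_comp => //; exact: measurableT_comp mv measurable_snd.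
have G0 z : (0 <= G z)%E by rewrite lee_fin mulr_ge0// indicE.
exact: (measurable_fun_fubini_tonelli_F (m2 := mu) G mG G0).
Qed.

(** Schur's test for the kernel 1_E, with weight p: by the Cauchy-Schwarz
    inequality applied to sqrt p and v / sqrt p on the section of E at t, the
    integrand at t is at most h t * P t times the integral of v^2 / p over that
    section; exchanging the integrals and using the bound on the columns
    concludes. *)
Lemma schur_test (E : set (R * R)) (h P p v : R -> R) (M : R) :
  measurable E -> measurable_fun [set: R] h -> measurable_fun [set: R] P ->
  measurable_fun [set: R] p -> measurable_fun [set: R] v ->
  0 <= M -> (forall t, 0 <= h t) -> (forall t, 0 <= P t) ->
  (forall t s, E (t, s) -> 0 < p s) ->
  (forall t, (\int[mu]_s (\1_E (t, s) * p s)%:E <= (P t)%:E)%E) ->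
  (forall s, 0 < p s ->
    (\int[mu]_t (\1_E (t, s) * (h t * P t))%:E <= (M * p s)%:E)%E) ->
  (\int[mu]_t ((h t)%:E * ((\int[mu]_s (\1_E (t, s) * `|v s|)%:E) *
                           (\int[mu]_s (\1_E (t, s) * `|v s|)%:E))) <=
   M%:E * \int[mu]_s (v s ^+ 2)%:E)%E.
Proof.
move=> mE mh mP mp mv M0 h0 P0 Ep rowP colP.
have m1E : measurable_fun [set: R * R] (\1_E : R * R -> R).
  exact: measurable_indic.
have E0 z : (0 : R) <= \1_E z by rewrite indicE.
have m1E1 t : measurable_fun [set: R] (fun s => \1_E (t, s) : R).
  exact: measurable_fun_pair2 m1E.
have m1E2 s : measurable_fun [set: R] (fun t => \1_E (t, s) : R).
  exact: measurable_fun_pair1 m1E.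
pose r s := Num.sqrt (p s).
have mr : measurable_fun [set: R] r.
  have msqrt : measurable_fun [set: R] (@Num.sqrt R).
    by apply: continuous_measurable_fun; exact: sqrt_continuous.
  exact: measurableT_comp msqrt mp.
pose q s := (v s / r s) ^+ 2.
have mvr : measurable_fun [set: R] (fun s => v s / r s).
  rewrite (_ : (fun s => _) = (fun s => v s * (r s `^ (- 1)))).
    apply: measurable_funM => //.
    exact: measurableT_comp (measurable_powR (- 1)) mr.
  by apply/funext => s; rewrite powR_inv1// sqrtr_ge0.
have mq : measurable_fun [set: R] q by exact: measurable_funX.
have q0 s : 0 <= q s by exact: sqr_ge0.
pose F (z : R * R) := (\1_E z * (h z.1 * P z.1 * q z.2))%:E.
have mF : measurable_fun [set: R * R] F.
  apply/measurable_EFinP; apply: measurable_funM => //.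
  apply: measurable_funM; last exact: measurableT_comp mq measurable_snd.
  by apply: measurable_funM; [exact: measurableT_comp mh measurable_fst|
    exact: measurableT_comp mP measurable_fst].
have F0 z : (0 <= F z)%E.
  rewrite /F lee_fin; apply: mulr_ge0; first by rewrite indicE.
  exact: (mulr_ge0 (mulr_ge0 (h0 _) (P0 _)) (q0 _)).
have step t : ((h t)%:E * ((\int[mu]_s (\1_E (t, s) * `|v s|)%:E) *
      (\int[mu]_s (\1_E (t, s) * `|v s|)%:E)) <= \int[mu]_s F (t, s))%E.
  have mf : measurable_fun [set: R] (fun s => \1_E (t, s) * r s).
    exact: measurable_funM.
  have mg : measurable_fun [set: R] (fun s => \1_E (t, s) * (v s / r s)).
    exact: measurable_funM.
  have := integral_cauchy_schwarz _ _ mf mg.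
  under eq_integral => s _.
    rewrite (_ : `|_| = \1_E (t, s) * `|v s|); last first.
      rewrite indicE; case: (boolP (_ \in _)) => [/set_mem/Ep ps|_].
        rewrite !mul1r mulrCA divff ?mulr1// gt_eqF//.
        by rewrite sqrtr_gt0.
      by rewrite !mul0r normr0.
    over.
  under [X in (_ <= X * _)%E -> _]eq_integral => s _.
    rewrite (_ : _ ^+ 2 = \1_E (t, s) * p s); last first.
      rewrite indicE; case: (boolP (_ \in _)) => [/set_mem/Ep ps|_].
        by rewrite !mul1r sqr_sqrtr// ltW.
      by rewrite !mul0r expr0n.
    over.
  under [X in (_ <= _ * X)%E -> _]eq_integral => s _.
    rewrite (_ : _ ^+ 2 = \1_E (t, s) * q s); last first.
      rewrite indicE; case: (boolP (_ \in _)) => [_|_]; first by rewrite !mul1r.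
      by rewrite !mul0r expr0n.
    over.
  move=> cs.
  have B0 : (0 <= \int[mu]_s (\1_E (t, s) * q s)%:E)%E.
    by apply: integral_ge0 => s _; rewrite lee_fin; exact: mulr_ge0.
  have {}cs := le_trans cs (lee_wpmul2r B0 (rowP t)).
  have h0' : (0 <= (h t)%:E)%E by rewrite lee_fin.
  apply: le_trans (lee_wpmul2l h0' cs) _.
  rewrite muleA -EFinM -ge0_integralZl_EFin//; first last.
  - by rewrite mulr_ge0.
  - by apply/measurable_EFinP; exact: measurable_funM (m1E1 t) mq.
  - by move=> s _; rewrite lee_fin mulr_ge0.
  rewrite le_eqVlt; apply/orP; left; apply/eqP; apply: eq_integral => s _.
  by rewrite -EFinM /F/= mulrCA.
have mI := measurable_section_integral _ _ mE mv.
have I0 := section_integral_ge0 E v.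
apply: (@le_trans _ _ (\int[mu]_t \int[mu]_s F (t, s))%E).
  apply: ge0_le_integral => //.
  - by move=> t _; rewrite mule_ge0// ?lee_fin// mule_ge0.
  - apply: emeasurable_funM; first exact/measurable_EFinP.
    exact: emeasurable_funM.
  - exact: (measurable_fun_fubini_tonelli_F (m2 := mu) F mF F0).
rewrite fubini_tonelli// -ge0_integralZl_EFin//; first last.
- by apply/measurable_EFinP; exact: measurable_funX.
- by move=> s _; rewrite lee_fin sqr_ge0.
apply: ge0_le_integral => //.
- by move=> s _; apply: integral_ge0.
- exact: (measurable_fun_fubini_tonelli_G (m1 := mu) F mF F0).
- apply/measurable_EFinP; apply: measurable_funM => //.
  exact: measurable_funX.
move=> s _; rewrite /F/=.
have [ps|ps] := ltP 0 (p s); last first.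
  rewrite (_ : q s = 0); last by rewrite /q /r ler0_sqrtr// invr0 mulr0 expr0n.
  rewrite integral0_eq => [|t _]; last by rewrite !mulr0.
  by rewrite -EFinM lee_fin mulr_ge0 ?sqr_ge0.
under eq_integral do rewrite mulrA mulrC EFinM.
rewrite ge0_integralZl_EFin//; first last.
- apply/measurable_EFinP.
  exact: measurable_funM (m1E2 s) (measurable_funM mh mP).
- by move=> t _; rewrite lee_fin; apply: mulr_ge0 => //; exact: mulr_ge0.
have q0' : (0 <= (q s)%:E)%E by rewrite lee_fin.
apply: le_trans (lee_wpmul2l q0' (colP s ps)) _.
rewrite -!EFinM lee_fin /q /r expr_div_n sqr_sqrtr ?(ltW ps)//.
by rewrite mulrCA divfK// gt_eqF.
Qed.

End schur.

(** * Wirtinger's inequality *)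

Section wirtinger_inequality.
Context {R : realType}.
Notation mu := (@lebesgue_measure R).
Notation norm2 := (@seminorm R (R -> R^o) L2ip).

Lemma integral_primitive (g G : R -> R) (a b : R) : a <= b ->
  (forall s, a <= s <= b -> is_derive s 1 G (g s)) ->
  (forall s, a <= s <= b -> {for s, continuous g}) ->
  (\int[mu]_(s in `[a, b]) (g s)%:E = (G b - G a)%:E)%E.
Proof.
rewrite le_eqVlt => /orP[/eqP<- _ _|ab dG cg].
  by rewrite set_itv1 integral_set1 subrr.
have cG s : a <= s <= b -> {for s, continuous G}.
  move=> /dG ds; apply/differentiable_continuous/derivable1_diffP.
  exact: (@ex_derive _ _ _ _ _ _ _ ds).
rewrite EFinB; apply: continuous_FTC2 => //.
- apply/continuous_in_subspaceT => s; rewrite inE/= in_itv/= => /cg; exact.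
- split.
  + move=> s; rewrite in_itv/= => /andP[as_ sb].
    have /dG ds : a <= s <= b by rewrite !ltW.
    exact: (@ex_derive _ _ _ _ _ _ _ ds).
  + have /cG h : a <= a <= b by rewrite lexx ltW.
    exact: cvg_at_right_filter.
  + have /cG h : a <= b <= b by rewrite lexx ltW.
    exact: cvg_at_left_filter.
- move=> s; rewrite in_itv/= => /andP[as_ sb].
  have /dG ds : a <= s <= b by rewrite !ltW.
  by rewrite derive1E (@derive_val _ _ _ _ _ _ _ ds).
Qed.

Lemma integral_le_primitive (f g G : R -> R) (a b : R) : a <= b ->
  measurable_fun [set: R] f -> (forall s, ~ (a <= s <= b) -> f s = 0) ->
  (forall s, a <= s <= b -> 0 <= f s <= g s) ->
  (forall s, a <= s <= b -> is_derive s 1 G (g s)) ->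
  (forall s, a <= s <= b -> {for s, continuous g}) ->
  (\int[mu]_s (f s)%:E <= (G b - G a)%:E)%E.
Proof.
move=> ab mf f0 fg dG cg; rewrite -(integral_primitive g)//.
have -> : (\int[mu]_s (f s)%:E = \int[mu]_(s in `[a, b]) (f s)%:E)%E.
  rewrite [RHS]integral_mkcond; apply: eq_integral => s _; rewrite patchE.
  case: ifPn => // /negP; rewrite inE/= in_itv/= => /f0 ->//.
apply: ge0_le_integral => //=.
- by move=> s; rewrite in_itv/= lee_fin => /fg/andP[].
- by apply/measurable_EFinP; exact: measurable_funTS.
- apply/measurable_EFinP; apply: subspace_continuous_measurable_fun => //.
  by apply/continuous_in_subspaceT => s; rewrite inE/= in_itv/= => /cg; exact.
- by move=> s; rewrite in_itv/= lee_fin => /fg/andP[].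
Qed.

Lemma measurable_le_prod (f g : R * R -> R) :
  measurable_fun [set: R * R] f -> measurable_fun [set: R * R] g ->
  measurable [set z | f z <= g z].
Proof.
move=> mf mg; rewrite -[X in measurable X]setTI.
have := measurable_fun_ler mf mg measurableT (Y := [set true]) I.
by congr measurable; apply/seteqP; split=> z /=.
Qed.

Lemma measurable_lt_prod (f g : R * R -> R) :
  measurable_fun [set: R * R] f -> measurable_fun [set: R * R] g ->
  measurable [set z | f z < g z].
Proof.
move=> mf mg; rewrite -[X in measurable X]setTI.
have := measurable_fun_ltr mf mg measurableT (Y := [set true]) I.
by congr measurable; apply/seteqP; split=> z /=.
Qed.

(** The section at t is the interval between c and t.  One of the two parts
    excludes s = c, as otherwise the column at c would meet both. *)
Definition wirtinger_set (c : R) : set (R * R) :=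
  [set z | [/\ c <= z.2, z.2 <= z.1 & z.1 < 1] \/
    [/\ 0 < z.1, z.1 <= z.2 & z.2 < c]].

Lemma is_derive_sin_scaled (c s : R) :
  is_derive s 1 (fun s => 2 / pi * sin (pi / 2 * (s - c)))
    (cos (pi / 2 * (s - c))).
Proof.
apply: is_derive_eq; rewrite /GRing.scale/=; 
have := lt0r_neq0 (pi_gt0 R); move: (pi : R) => q q0.
by field.
Qed.

Lemma is_derive_cos_scaled (c s : R) :
  is_derive s 1 (fun s => - (2 / pi) * cos (pi / 2 * (s - c)))
    (sin (pi / 2 * (s - c))).
Proof.
apply: is_derive_eq; rewrite /GRing.scale/=; 
have := lt0r_neq0 (pi_gt0 R); move: (pi : R) => q q0.
by field.
Qed.

Lemma continuous_sin_scaled (c : R) :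
  continuous (fun s => sin (pi / 2 * (s - c))).
Proof.
move=> s; apply: (@continuous_comp _ _ _ (fun s => pi / 2 * (s - c)) sin).
  by apply: cvgMr; apply: cvgB => //; exact: cvg_cst.
exact: continuous_sin.
Qed.

Lemma continuous_cos_scaled (c : R) :
  continuous (fun s => cos (pi / 2 * (s - c))).
Proof.
move=> s; apply: (@continuous_comp _ _ _ (fun s => pi / 2 * (s - c)) cos).
  by apply: cvgMr; apply: cvgB => //; exact: cvg_cst.
exact: continuous_cos.
Qed.

Lemma cos_scaled_gt0 (x : R) : -1 < x < 1 -> 0 < cos (pi / 2 * x).
Proof.
move=> /andP[x1 x2]; have p0 := pi_gt0 R.
have p20 : 0 < pi / 2 :> R by rewrite divr_gt0.
apply: cos_gt0_pihalf; apply/andP; split.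
  by rewrite -[X in X < _]mulrN1 ltr_pM2l.
by rewrite -[X in _ < X]mulr1 ltr_pM2l.
Qed.

Lemma cos_scaled_ge0 (x : R) : -1 <= x <= 1 -> 0 <= cos (pi / 2 * x).
Proof.
move=> /andP[x1 x2]; have p0 := pi_gt0 R.
have p20 : 0 <= pi / 2 :> R by rewrite divr_ge0// ltW.
apply: cos_ge0_pihalf; apply/andP; split.
  by rewrite -[X in X <= _]mulrN1 ler_wpM2l.
by rewrite -[X in _ <= X]mulr1 ler_wpM2l.
Qed.

Lemma sin_scaled_ge0 (x : R) : 0 <= x <= 1 -> 0 <= sin (pi / 2 * x).
Proof.
move=> /andP[x1 x2]; have p0 := pi_gt0 R.
apply: sin_ge0_pi; apply/andP; split.
  by rewrite mulr_ge0// divr_ge0// ltW.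
have : pi * x <= pi * 1 by rewrite ler_pM2l.
by lra.
Qed.

Lemma sin_scaled_opp (x : R) : sin (pi / 2 * - x) = - sin (pi / 2 * x).
Proof. by rewrite mulrN sinN. Qed.

Lemma measurable_wirtinger_set (c : R) : measurable (wirtinger_set c).
Proof.
have mc (k : R) : measurable_fun [set: R * R] (fun=> k) by exact: measurable_cst.
have le f g := @measurable_le_prod f g; have lt f g := @measurable_lt_prod f g.
have m1 : measurable_fun [set: R * R] (fun z : R * R => z.1) := measurable_fst.
have m2 : measurable_fun [set: R * R] (fun z : R * R => z.2) := measurable_snd.
rewrite (_ : wirtinger_set c =
   ([set z | c <= z.2] `&` [set z | z.2 <= z.1] `&` [set z | z.1 < 1]) `|`
   ([set z | 0 < z.1] `&` [set z | z.1 <= z.2] `&` [set z | z.2 < c])).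
  apply: measurableU; apply: measurableI.
  - apply: measurableI; first exact: (le _ _ (mc c) m2).
    exact: (le _ _ m2 m1).
  - exact: (lt _ _ m1 (mc 1)).
  - apply: measurableI; first exact: (lt _ _ (mc 0) m1).
    exact: (le _ _ m1 m2).
  - exact: (lt _ _ m2 (mc c)).
apply/seteqP; split=> z /=.
  by move=> [[h1 h2 h3]|[h1 h2 h3]]; [left|right].
by move=> [[[h1 h2] h3]|[[h1 h2] h3]]; [left|right]; split.
Qed.

(** Wirtinger's inequality for functions vanishing at c, whose value at t is at
    most the integral of |v| between c and t.  The weight cos (pi / 2 * (s - c))
    is the derivative of sin (pi / 2 * (s - c)), which is extremal when c is an
    end of [0, 1]; it makes both hypotheses of Schur's test elementary
    integrals. *)
Lemma wirtinger (c : R) (v : R -> R) : I01 c -> measurable_fun [set: R] v ->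
  (\int[mu]_t ((\int[mu]_s (\1_(wirtinger_set c) (t, s) * `|v s|)%:E) *
               (\int[mu]_s (\1_(wirtinger_set c) (t, s) * `|v s|)%:E)) <=
   ((2 / pi) ^+ 2)%:E * \int[mu]_s (v s ^+ 2)%:E)%E.
Proof.
rewrite /I01/= in_itv/= => /andP[c0 c1] mv.
have p0 := pi_gt0 R; have p2 : 0 <= 2 / pi :> R by rewrite divr_ge0// ltW.
have mE := measurable_wirtinger_set c.
have mi : measurable_fun [set: R * R] (\1_(wirtinger_set c) : R * R -> R).
  exact: measurable_indic.
pose p s := cos (pi / 2 * (s - c)); pose P t := 2 / pi * `|sin (pi / 2 * (t - c))|.
have mp : measurable_fun [set: R] p.
  by apply: continuous_measurable_fun; exact: continuous_cos_scaled.
have mP : measurable_fun [set: R] P.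
  apply: measurable_funM => //; apply: measurableT_comp => //.
  by apply: continuous_measurable_fun; exact: continuous_sin_scaled.
have P0 t : 0 <= P t by rewrite mulr_ge0.
have Ep t s : wirtinger_set c (t, s) -> 0 < p s.
  by move=> [[/= *]|[/= *]]; apply: cos_scaled_gt0; apply/andP; split; lra.
have mrow t : measurable_fun [set: R]
    (fun s => \1_(wirtinger_set c) (t, s) * p s).
  by apply: measurable_funM => //; exact: measurable_fun_pair2 mi.
have mcol s : measurable_fun [set: R]
    (fun t => \1_(wirtinger_set c) (t, s) * (1 * P t)).
  apply: measurable_funM; first exact: measurable_fun_pair1 mi.
  exact: measurable_funM.
have in0 z : ~ wirtinger_set c z -> \1_(wirtinger_set c) z = 0 :> R.
  by move=> nz; rewrite indicE memNset.
have in1 z : (\1_(wirtinger_set c) z : R) <= 1.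
  by rewrite indicE lern1 leq_b1.
have in_ge0 z : 0 <= (\1_(wirtinger_set c) z : R) by rewrite indicE.
have row t : (\int[mu]_s (\1_(wirtinger_set c) (t, s) * p s)%:E <= (P t)%:E)%E.
  have dG := is_derive_sin_scaled c; have cg := continuous_cos_scaled c.
  have bnd a b : a <= b -> -1 <= a - c -> b - c <= 1 ->
      (forall s, wirtinger_set c (t, s) -> a <= s <= b) ->
      (\int[mu]_s (\1_(wirtinger_set c) (t, s) * p s)%:E <=
        (2 / pi * sin (pi / 2 * (b - c)) - 2 / pi * sin (pi / 2 * (a - c)))%:E)%E.
    move=> ab ac bc h.
    apply: (@integral_le_primitive _ p (fun s => 2 / pi * sin (pi / 2 * (s - c))))
      => // s; [|move=> /andP[as_ sb]|by move=> _; exact: cg].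
      by move=> nh; rewrite in0 ?mul0r// => /h.
    have ps : 0 <= p s by apply: cos_scaled_ge0; apply/andP; split; lra.
    by rewrite mulr_ge0//= ler_piMl.
  have [t01|nt01] := pselect (0 <= t < 1); last first.
    rewrite integral0_eq ?lee_fin// => s _; rewrite in0 ?mul0r//.
    by move=> [[/= *]|[/= *]]; apply: nt01; apply/andP; split; lra.
  move: t01 => /andP[t0 t1]; have [ct|tc] := lerP c t.
    apply: (le_trans (bnd c t ct _ _ _)); [lra|lra| |].
      by move=> s [[/= *]|[/= *]]; apply/andP; split; lra.
    by rewrite subrr mulr0 sin0 mulr0 subr0 lee_fin /P ler_wpM2l// ler_norm.
  apply: (le_trans (bnd t c (ltW tc) _ _ _)); [lra|lra| |].
    by move=> s [[/= *]|[/= *]]; apply/andP; split; lra.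
  rewrite subrr mulr0 sin0 mulr0 sub0r lee_fin /P -mulrN ler_wpM2l//.
  by rewrite -normrN ler_norm.
have col s : 0 < p s ->
    (\int[mu]_t (\1_(wirtinger_set c) (t, s) * (1 * P t))%:E <=
     ((2 / pi) ^+ 2 * p s)%:E)%E.
  move=> ps.
  have [s01|ns01] := pselect (0 <= s < 1); last first.
    rewrite integral0_eq => [|t _].
      by rewrite lee_fin mulr_ge0 ?sqr_ge0 ?(ltW ps).
    rewrite in0 ?mul0r//.
    by move=> [[/= *]|[/= *]]; apply: ns01; apply/andP; split; lra.
  move: s01 => /andP[s0 s1]; have [cs|sc] := lerP c s.
    apply: (@le_trans _ _ (2 / pi * (- (2 / pi) * cos (pi / 2 * (1 - c))) -
      2 / pi * (- (2 / pi) * cos (pi / 2 * (s - c))))%:E).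
      apply: (@integral_le_primitive _
        (fun t => 2 / pi * sin (pi / 2 * (t - c)))
        (fun t => 2 / pi * (- (2 / pi) * cos (pi / 2 * (t - c))))) => //.
      + exact: ltW.
      + move=> t nt; rewrite in0 ?mul0r// => -[[/= *]|[/= *]]; last by lra.
        by apply: nt; apply/andP; split; lra.
      + move=> t /andP[st t1].
        have s0' : 0 <= sin (pi / 2 * (t - c)).
          by apply: sin_scaled_ge0; apply/andP; split; lra.
        rewrite mul1r /P ger0_norm// mulr_ge0//=; last exact: mulr_ge0.
        by apply: ler_piMl => //; exact: mulr_ge0.
      + by move=> t _; apply: is_deriveZ; exact: is_derive_cos_scaled.
      + by move=> t _; apply: cvgMr; exact: continuous_sin_scaled.
    rewrite lee_fin -subr_ge0 /p.
    have : 0 <= cos (pi / 2 * (1 - c)).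
      by apply: cos_scaled_ge0; apply/andP; split; lra.
    move/(mulr_ge0 (mulr_ge0 p2 p2)); lra.
  apply: (@le_trans _ _ (2 / pi * (2 / pi * cos (pi / 2 * (s - c))) -
      2 / pi * (2 / pi * cos (pi / 2 * (0 - c))))%:E).
    apply: (@integral_le_primitive _
      (fun t => 2 / pi * - sin (pi / 2 * (t - c)))
      (fun t => 2 / pi * (2 / pi * cos (pi / 2 * (t - c))))) => //.
    + move=> t nt; rewrite in0 ?mul0r// => -[[/= *]|[/= *]]; first by lra.
      by apply: nt; apply/andP; split; lra.
    + move=> t /andP[st t1].
      have s0' : 0 <= - sin (pi / 2 * (t - c)).
        rewrite -sin_scaled_opp.
        by apply: sin_scaled_ge0; apply/andP; split; lra.
      rewrite mul1r /P -normrN ger0_norm// mulr_ge0//=; last exact: mulr_ge0.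
      by apply: ler_piMl => //; exact: mulr_ge0.
    + move=> t _; apply: is_derive_eq; rewrite /GRing.scale/=.
      have := lt0r_neq0 p0; move: (pi : R) => q q0.
      by field.
    + by move=> t _; apply: cvgMr; apply: cvgN; exact: continuous_sin_scaled.
  rewrite lee_fin -subr_ge0 /p.
  have : 0 <= cos (pi / 2 * (0 - c)).
    by apply: cos_scaled_ge0; apply/andP; split; lra.
  move/(mulr_ge0 (mulr_ge0 p2 p2)); lra.
have := @schur_test R (wirtinger_set c) (fun=> 1) P p v ((2 / pi) ^+ 2) mE
  (measurable_cst _) mP mp mv (sqr_ge0 _) (fun=> ler01) P0 Ep row col.
by under eq_integral do rewrite mul1e.
Qed.

End wirtinger_inequality.

(** * A weighted Hardy inequality *)

Section hardy_inequality.
Context {R : realType}.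
Notation mu := (@lebesgue_measure R).
Notation norm2 := (@seminorm R (R -> R^o) L2ip).

Lemma measurable_patchT (D : set R) (f : R -> \bar R) : measurable D ->
  measurable_fun [set: R] f -> measurable_fun [set: R] (f \_ D).
Proof.
move=> mD mf; have [+ _] := measurable_restrictT f mD; apply.
exact: measurable_funTS.
Qed.

Lemma measurable_sqrtr : measurable_fun [set: R] (@Num.sqrt R).
Proof. by apply: continuous_measurable_fun; exact: sqrt_continuous. Qed.

Lemma measurable_inv_sqrtr :
  measurable_fun [set: R] (fun s : R => (Num.sqrt s)^-1).
Proof.
rewrite (_ : (fun s => _) = (fun s => Num.sqrt s `^ (- 1))); last first.
  by apply/funext => s; rewrite powR_inv1// sqrtr_ge0.
exact: measurableT_comp (measurable_powR (- 1)) measurable_sqrtr.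
Qed.

Lemma is_derive_sqrtr (s : R) : 0 < s ->
  is_derive s 1 (fun s => 2 * Num.sqrt s) (Num.sqrt s)^-1.
Proof.
move=> s0; have ds := is_derive1_sqrt s0.
apply: is_derive_eq; rewrite /GRing.scale/=.
by field; rewrite gt_eqF// sqrtr_gt0.
Qed.

Lemma continuous_inv_sqrtr (s : R) : 0 < s ->
  {for s, continuous (fun s => (Num.sqrt s)^-1)}.
Proof.
by move=> s0; apply: cvgV; [rewrite gt_eqF ?sqrtr_gt0|exact: sqrt_continuous].
Qed.

Lemma is_derive_inv_sqrtr (l s : R) : 0 < s ->
  is_derive s 1 (fun s => - (2 * l) * (Num.sqrt s)^-1) (l / s * (Num.sqrt s)^-1).
Proof.
move=> s0; have ds := is_derive1_sqrt s0.
have s0' : Num.sqrt s != 0 by rewrite gt_eqF// sqrtr_gt0.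
have dv := is_deriveV (f := @Num.sqrt R) s0' ds.
apply: is_derive_eq; rewrite /GRing.scale/=.
rewrite -[X in _ = l / X * _](sqr_sqrtr (ltW s0)).
by field.
Qed.

(** The integrand is singular at 0: the integrals over [1 / (n + 1), t] are
    computed from a primitive, and increase to the one over (0, t]. *)
Lemma integral_inv_sqrtr (t : R) :
  (\int[mu]_(s in `]0%R, t]) ((Num.sqrt s)^-1)%:E <= (2 * Num.sqrt t)%:E)%E.
Proof.
have mf : measurable_fun [set: R] (fun s : R => ((Num.sqrt s)^-1)%:E).
  by apply/measurable_EFinP; exact: measurable_inv_sqrtr.
pose F n : set R := `[n.+1%:R^-1, t]%classic.
have UF : \bigcup_n F n = `]0%R, t]%classic.
  apply/seteqP; split=> s.
    move=> [n _]; rewrite /F/= !in_itv/= => /andP[ns ->]; rewrite andbT.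
    by rewrite (lt_le_trans _ ns)// invr_gt0.
  rewrite /= in_itv/= => /andP[s0 st].
  have [n _ /(_ n (leqnn n)) hn] := near_infty_natSinv_lt (PosNum s0).
  by exists n => //; rewrite /F/= in_itv/= st andbT ltW.
have ndF : {homo F : n m / (n <= m)%N >-> (n <= m)%O}.
  move=> n m nm; apply/subsetPset => s; rewrite /F/= !in_itv/= => /andP[ns ->].
  by rewrite andbT (le_trans _ ns)// lef_pV2 ?posrE// ler_nat.
have mF n : measurable (F n) by exact: measurable_itv.
have mfF n : measurable_fun (F n) (fun s : R => ((Num.sqrt s)^-1)%:E).
  exact: measurable_funTS.
have f0 n s : F n s -> (0 <= ((Num.sqrt s)^-1)%:E)%E.
  by rewrite lee_fin invr_ge0 sqrtr_ge0.
have cvgF := @ge0_nondecreasing_set_cvg_integral _ (measurableTypeR R) R F _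
  mu ndF mF mfF f0.
rewrite -UF -(cvg_lim _ cvgF)//; apply: lime_le; first exact: cvgP cvgF.
apply: nearW => n; have n0 : 0 < n.+1%:R^-1 :> R by rewrite invr_gt0.
have [nt|tn] := lerP n.+1%:R^-1 t; last first.
  rewrite /F set_itv_ge ?integral_set0 ?lee_fin ?mulr_ge0 ?sqrtr_ge0//.
  by rewrite bnd_simp -ltNge.
apply: (@le_trans _ _ (2 * Num.sqrt t - 2 * Num.sqrt n.+1%:R^-1)%:E); last first.
  by rewrite lee_fin gerBl mulr_ge0// sqrtr_ge0.
rewrite le_eqVlt; apply/orP; left; apply/eqP.
apply: (@integral_primitive R _ (fun s => 2 * Num.sqrt s)) => [//|s|s].
- by move=> /andP[ns _]; apply: is_derive_sqrtr; exact: lt_le_trans ns.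
- by move=> /andP[ns _]; apply: continuous_inv_sqrtr; exact: lt_le_trans ns.
Qed.

(** The section at t in (0, 1] is (0, t] without the point 1, where the tail
    bound of the weight is not assumed. *)
Definition hardy_set : set (R * R) :=
  [set z | [/\ 0 < z.2, z.2 < 1, z.2 <= z.1 & z.1 <= 1]].

Lemma measurable_hardy_set : measurable hardy_set.
Proof.
have mc (k : R) : measurable_fun [set: R * R] (fun=> k) by exact: measurable_cst.
have le f g := @measurable_le_prod R f g.
have lt f g := @measurable_lt_prod R f g.
have m1 : measurable_fun [set: R * R] (fun z : R * R => z.1) := measurable_fst.
have m2 : measurable_fun [set: R * R] (fun z : R * R => z.2) := measurable_snd.
rewrite (_ : hardy_set =
   ([set z | 0 < z.2] `&` [set z | z.2 < 1]) `&`
   ([set z | z.2 <= z.1] `&` [set z | z.1 <= 1])).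
  apply: measurableI; apply: measurableI.
  - exact: (lt _ _ (mc 0) m2).
  - exact: (lt _ _ m2 (mc 1)).
  - exact: (le _ _ m2 m1).
  - exact: (le _ _ m1 (mc 1)).
apply/seteqP; split=> z /=; first by move=> [? ? ? ?].
by move=> [[? ?] [? ?]].
Qed.

Section hardy.
Context (h : R -> R) (l : R) (mh : measurable_fun [set: R] h)
  (h0 : forall t, 0 <= h t) (l0 : 0 <= l)
  (hl : forall t, 0 < t < 1 ->
    (\int[mu]_(s in `[t, 1%R]) (h s)%:E <= (l / t)%:E)%E).

(** Integration by parts moves the integral onto the tail of h, which is at most
    l / r.  It takes the form of Tonelli's theorem, after writing 2 * sqrt t as
    2 * sqrt s plus the integral of 1 / sqrt r over [s, t]. *)
Lemma tail_integral_sqrtr (s : R) : 0 < s < 1 ->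
  (\int[mu]_(t in `[s, 1%R]) (h t * (2 * Num.sqrt t))%:E <=
   (4 * l * (Num.sqrt s)^-1)%:E)%E.
Proof.
move=> s01; have [s0 s1] := andP s01.
pose E := [set z : R * R | [/\ s <= z.2, z.2 <= z.1 & z.1 <= 1]].
have mc (k : R) : measurable_fun [set: R * R] (fun=> k) by exact: measurable_cst.
have m1 : measurable_fun [set: R * R] (fun z : R * R => z.1) := measurable_fst.
have m2 : measurable_fun [set: R * R] (fun z : R * R => z.2) := measurable_snd.
have mE : measurable E.
  rewrite (_ : E = [set z | s <= z.2] `&` [set z | z.2 <= z.1] `&`
      [set z | z.1 <= 1]).
    apply: measurableI; first apply: measurableI.
    - exact: (measurable_le_prod _ _ (mc s) m2).
    - exact: (measurable_le_prod _ _ m2 m1).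
    - exact: (measurable_le_prod _ _ m1 (mc 1)).
  apply/seteqP; split=> z /=; first by move=> [? ? ?].
  by move=> [[? ?] ?].
have mi : measurable_fun [set: R * R] (\1_E : R * R -> R).
  exact: measurable_indic.
pose F (z : R * R) := (\1_E z * (h z.1 * (Num.sqrt z.2)^-1))%:E.
have mF : measurable_fun [set: R * R] F.
  apply/measurable_EFinP; apply: measurable_funM => //.
  apply: measurable_funM; first exact: measurableT_comp mh measurable_fst.
  exact: measurableT_comp measurable_inv_sqrtr measurable_snd.
have F0 z : (0 <= F z)%E.
  rewrite /F lee_fin; apply: mulr_ge0; first by rewrite indicE.
  by apply: mulr_ge0; [exact: h0|rewrite invr_ge0 sqrtr_ge0].
have E1 t r : s <= r -> r <= t -> t <= 1 -> \1_E (t, r) = 1 :> R.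
  by move=> *; rewrite indicE mem_set.
have E0 t r : ~ [/\ s <= r, r <= t & t <= 1] -> \1_E (t, r) = 0 :> R.
  by move=> nE; rewrite indicE memNset.
have inner t : s <= t <= 1 ->
    (\int[mu]_r F (t, r) = (h t * (2 * Num.sqrt t) - h t * (2 * Num.sqrt s))%:E)%E.
  move=> /andP[st t1].
  have -> : (\int[mu]_r F (t, r) =
      \int[mu]_(r in `[s, t]) (h t * (Num.sqrt r)^-1)%:E)%E.
    rewrite [RHS]integral_mkcond; apply: eq_integral => r _; rewrite patchE.
    case: ifPn => [|/negP]; rewrite inE/= in_itv/= /F/=.
      by move=> /andP[sr rt]; rewrite E1// mul1r.
    by move=> nr; rewrite E0 ?mul0r// => -[sr rt _]; apply: nr; rewrite sr.
  apply: (@integral_primitive R _ (fun r => h t * (2 * Num.sqrt r))) => [//|r|r].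
  - by move=> /andP[sr _]; apply: is_deriveZ; apply: is_derive_sqrtr; lra.
  - by move=> /andP[sr _]; apply: cvgMr; apply: continuous_inv_sqrtr; lra.
have outer r : s <= r <= 1 ->
    (\int[mu]_t F (t, r) <= (l / r * (Num.sqrt r)^-1)%:E)%E.
  move=> /andP[sr r1].
  have -> : (\int[mu]_t F (t, r) =
      \int[mu]_(t in `[r, 1%R]) ((Num.sqrt r)^-1%:E * (h t)%:E))%E.
    rewrite [RHS]integral_mkcond; apply: eq_integral => t _; rewrite patchE.
    case: ifPn => [|/negP]; rewrite inE/= in_itv/= /F/=.
      by move=> /andP[rt t1]; rewrite E1// mul1r -EFinM mulrC.
    by move=> nr; rewrite E0 ?mul0r// => -[_ rt t1]; apply: nr; rewrite rt.
  rewrite ge0_integralZl_EFin//; first last.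
  - by apply: measurable_funTS; exact/measurable_EFinP.
  - by move=> t _; rewrite lee_fin.
  rewrite mulrC EFinM; apply: lee_wpmul2l.
    by rewrite lee_fin invr_ge0 sqrtr_ge0.
  move: r1; rewrite le_eqVlt => /orP[/eqP ->|r1].
    by rewrite set_itv1 integral_set1 lee_fin divr_ge0.
  by apply: hl; apply/andP; split; lra.
have mh2 : measurable_fun `[s, 1] (fun t => (Num.sqrt s * 2 * h t)%:E).
  by apply: measurable_funTS; apply/measurable_EFinP; exact: measurable_funM.
have mG : measurable_fun [set: R] (fun t => \int[mu]_r F (t, r))%E.
  exact: (measurable_fun_fubini_tonelli_F (m2 := mu) F mF F0).
have mG2 : measurable_fun [set: R] (fun r => \int[mu]_t F (t, r))%E.
  exact: (measurable_fun_fubini_tonelli_G (m1 := mu) F mF F0).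
have -> : (\int[mu]_(t in `[s, 1%R]) (h t * (2 * Num.sqrt t))%:E =
    \int[mu]_(t in `[s, 1%R])
      ((Num.sqrt s * 2)%:E * (h t)%:E + \int[mu]_r F (t, r)))%E.
  apply: eq_integral => t; rewrite inE/= in_itv/= => st; rewrite inner//.
  by rewrite -EFinM -EFinD; congr EFin; ring.
rewrite ge0_integralD//; first last.
- exact: measurable_funTS.
- by move=> t _; apply: integral_ge0.
- by move=> t _; rewrite -EFinM lee_fin !mulr_ge0// sqrtr_ge0.
rewrite ge0_integralZl_EFin//; first last.
- by apply: measurable_funTS; exact/measurable_EFinP.
- by move=> t _; rewrite lee_fin.
have s2 : 0 <= Num.sqrt s * 2 by rewrite mulr_ge0// sqrtr_ge0.
have Is : (\int[mu]_(t in `[s, 1%R]) \int[mu]_r F (t, r) <=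
    (- (2 * l) * (Num.sqrt 1)^-1 - - (2 * l) * (Num.sqrt s)^-1)%:E)%E.
  apply: (@le_trans _ _ (\int[mu]_t \int[mu]_r F (t, r))%E).
    by apply: ge0_subset_integral => // t _; exact: integral_ge0.
  rewrite fubini_tonelli//.
  have -> : (\int[mu]_r \int[mu]_t F (t, r) =
      \int[mu]_(r in `[s, 1%R]) \int[mu]_t F (t, r))%E.
    rewrite [RHS]integral_mkcond; apply: eq_integral => r _; rewrite patchE.
    case: ifPn => // /negP; rewrite inE/= in_itv/= => nr.
    rewrite integral0_eq// => t _; rewrite /F E0 ?mul0r// => -[sr rt t1].
    by apply: nr; rewrite sr (le_trans rt).
  have Fprim r : s <= r <= 1 -> is_derive r 1 (fun r => - (2 * l) * (Num.sqrt r)^-1)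
      (l / r * (Num.sqrt r)^-1).
    by move=> /andP[sr _]; apply: is_derive_inv_sqrtr; lra.
  have Fcont r : s <= r <= 1 ->
      {for r, continuous (fun x : R => l / x * (Num.sqrt x)^-1)}.
    move=> /andP[sr _]; have r0 : 0 < r by lra.
    apply: cvgM; last exact: continuous_inv_sqrtr.
    by apply: cvgMr; apply: cvgV => //; rewrite gt_eqF.
  rewrite -(@integral_primitive R _ _ _ _ (ltW s1) Fprim Fcont).
  apply: ge0_le_integral => //.
  - by move=> r _; exact: integral_ge0.
  - exact: measurable_funTS.
  - apply/measurable_EFinP; apply: subspace_continuous_measurable_fun => //.
    by apply/continuous_in_subspaceT => r; rewrite inE/= in_itv/= => /Fcont; exact.
have Hs : (\int[mu]_(t in `[s, 1%R]) (h t)%:E <= (l / s)%:E)%E by exact: hl.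
have s2' : (0 <= (Num.sqrt s * 2)%:E)%E by rewrite lee_fin.
have := leeD (lee_wpmul2l s2' Hs) Is; move=> /le_trans; apply.
rewrite -EFinM -EFinD lee_fin sqrtr1 invr1.
have q0 : 0 < Num.sqrt s by rewrite sqrtr_gt0.
rewrite -[X in _ * (l / X)](sqr_sqrtr (ltW s0)).
rewrite (_ : _ * 2 * _ = 2 * l * (Num.sqrt s)^-1).
  by move: (Num.sqrt s)^-1 l0 => x ll; have := ll; rewrite -subr_ge0; nra.
by field; rewrite gt_eqF.
Qed.

(** Hardy's inequality for functions vanishing at 0, with a weight whose tail is
    at most l / t in place of 1 / t ^ 2: Schur's test for 1 / sqrt s, the weight
    that gives the classical inequality its best constant. *)
Lemma weighted_hardy (v : R -> R) : measurable_fun [set: R] v ->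
  (\int[mu]_t ((h t)%:E * ((\int[mu]_s (\1_hardy_set (t, s) * `|v s|)%:E) *
               (\int[mu]_s (\1_hardy_set (t, s) * `|v s|)%:E))) <=
   (4 * l)%:E * \int[mu]_s (v s ^+ 2)%:E)%E.
Proof.
move=> mv.
have mi : measurable_fun [set: R * R] (\1_hardy_set : R * R -> R).
  by apply: measurable_indic; exact: measurable_hardy_set.
have in_ge0 z : 0 <= (\1_hardy_set z : R) by rewrite indicE.
have in0 z : ~ hardy_set z -> \1_hardy_set z = 0 :> R.
  by move=> nz; rewrite indicE memNset.
have in1 z : (\1_hardy_set z : R) <= 1.
  by rewrite indicE lern1 leq_b1.
have mP : measurable_fun [set: R] (fun t : R => 2 * Num.sqrt t).
  by apply: measurable_funM => //; exact: measurable_sqrtr.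
apply: (@schur_test R hardy_set h (fun t => 2 * Num.sqrt t)
  (fun s => (Num.sqrt s)^-1) v (4 * l) measurable_hardy_set mh mP
  measurable_inv_sqrtr mv).
- by rewrite mulr_ge0.
- exact: h0.
- by move=> t; rewrite mulr_ge0// sqrtr_ge0.
- by move=> t s [/= s0 _ _ _]; rewrite invr_gt0 sqrtr_gt0.
- move=> t; apply: le_trans (integral_inv_sqrtr t).
  rewrite [leRHS]integral_mkcond; apply: ge0_le_integral => //.
  + apply/measurable_EFinP; apply: measurable_funM.
      exact: measurable_fun_pair2 mi.
    exact: measurable_inv_sqrtr.
  + apply: measurable_patchT; first exact: measurable_itv.
    apply/measurable_EFinP.
    exact: measurable_inv_sqrtr.
  + move=> s _; rewrite patchE; case: ifPn => [_|/negP].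
      by rewrite lee_fin ler_piMl// invr_ge0 sqrtr_ge0.
    rewrite inE/= in_itv/= => sn; rewrite in0 ?mul0r// => -[/= s0 _ st _].
    by apply: sn; rewrite s0.
- move=> s; rewrite invr_gt0 sqrtr_gt0 => s0.
  have [s1|s1] := ltP s 1; last first.
    rewrite integral0_eq => [|t _].
      by rewrite lee_fin !mulr_ge0// invr_ge0 sqrtr_ge0.
    by rewrite in0 ?mul0r// => -[/= _ ? _ _]; lra.
  have s01 : 0 < s < 1 by rewrite s0.
  apply: le_trans (tail_integral_sqrtr s s01).
  rewrite [leRHS]integral_mkcond; apply: ge0_le_integral => //.
  + move=> t _; rewrite lee_fin; apply: mulr_ge0 => //.
    by apply: mulr_ge0; [exact: h0|rewrite mulr_ge0// sqrtr_ge0].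
  + apply/measurable_EFinP; apply: measurable_funM.
      exact: measurable_fun_pair1 mi.
    exact: measurable_funM.
  + apply: measurable_patchT; first exact: measurable_itv.
    apply/measurable_EFinP.
    exact: measurable_funM.
  + move=> t _; rewrite patchE; case: ifPn => [_|/negP].
      by rewrite lee_fin ler_piMl// mulr_ge0// mulr_ge0// sqrtr_ge0.
    rewrite inE/= in_itv/= => tn; rewrite in0 ?mul0r// => -[/= _ _ st t1].
    by apply: tn; rewrite st.
Qed.

End hardy.

End hardy_inequality.

(** * Indefinite integrals of L2 functions *)

Section indefinite_integral.
Context {R : realType}.
Notation mu := (@lebesgue_measure R).
Notation norm2 := (@seminorm R (R -> R^o) L2ip).

Section primitive.
Context (v : R -> R) (sv : sq_int01 v).

Definition primitive (t : R) : R := \int[mu]_(s in `]-oo, t]) v s.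

Lemma integrable_sub (D : set R) : measurable D -> mu.-integrable D (EFin \o v).
Proof.
move=> mD; apply: (@integrableS _ (measurableTypeR R) R mu setT) => //.
exact: sq_int01_integrable.
Qed.

Lemma primitiveB (a b : R) : a <= b ->
  primitive b - primitive a = \int[mu]_(s in `]a, b]) v s.
Proof.
move=> ab; rewrite /primitive Rintegral_itvB// ?bnd_simp//.
by apply: integrable_sub; exact: measurable_itv.
Qed.

Lemma primitive_dist (a b : R) : a <= b ->
  (`|primitive b - primitive a|%:E <= \int[mu]_(s in `]a, b]) `|v s|%:E)%E.
Proof.
move=> ab; have iv : mu.-integrable `]a, b] (EFin \o v).
  by apply: integrable_sub; exact: measurable_itv.
rewrite primitiveB// EFin_normr_Rintegral//; apply: le_abse_integral => //.
by case/integrableP: iv.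
Qed.

Lemma sq_int01_restrict (D : set R) : measurable D -> sq_int01 (v \_ D).
Proof.
move=> mD; apply: (sq_int01_le _ v) => //; last first.
  by move=> t; rewrite patchE; case: ifPn => // _; rewrite normr0.
have [mv _ _] := sv; have [+ _] := measurable_restrictT v mD; apply.
exact: measurable_funTS.
Qed.

(** The norm is kept on ]a, b] only, because it is additive over disjoint
    intervals. *)
Lemma primitive_dist_sqr (a b : R) : a <= b ->
  (primitive b - primitive a) ^+ 2 <= (b - a) * norm2 (v \_ `]a, b]) ^+ 2.
Proof.
move=> ab; set D := `]a, b]%classic.
have mD : measurable D by exact: measurable_itv.
have sD := sq_int01_restrict _ mD.
have mi : measurable_fun [set: R] (\1_D : R -> R) by exact: measurable_indic.
have [mg _ _] := sD.
have := integral_cauchy_schwarz _ _ mi mg.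
have -> : (\int[mu]_t (\1_D t ^+ 2)%:E = (b - a)%:E)%E.
  under eq_integral do rewrite indicE -natrX expnS expn1 mulnb andbb -indicE.
  rewrite integral_indic// setIT.
  rewrite [LHS]lebesgue_measure_itv/= lte_fin.
  by move: ab; rewrite le_eqVlt => /orP[/eqP->|->//]; rewrite ltxx subrr.
rewrite -norm2_sqr//.
have -> : (\int[mu]_t `|\1_D t * (v \_ D) t|%:E = \int[mu]_(t in D) `|v t|%:E)%E.
  rewrite [RHS]integral_mkcond; apply: eq_integral => t _.
  rewrite !patchE indicE; case: (boolP (t \in D)) => _; first by rewrite mul1r.
  by rewrite mul0r normr0.
move=> cs; rewrite -lee_fin; apply: le_trans cs.
have d := primitive_dist _ _ ab.
by rewrite -(real_normK (num_real _)) expr2 EFinM; apply: lee_pmul.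
Qed.

Lemma norm2_restrict_add (a b c : R) : a <= b -> b <= c ->
  norm2 (v \_ `]a, b]) ^+ 2 + norm2 (v \_ `]b, c]) ^+ 2 <= norm2 v ^+ 2.
Proof.
move=> ab bc.
have s1 := sq_int01_restrict _ (measurable_itv `]a, b]).
have s2 := sq_int01_restrict _ (measurable_itv `]b, c]).
have [[m1 _ _] [m2 _ _] [mv _ _]] := And3 s1 s2 sv.
rewrite -lee_fin EFinD !norm2_sqr// -ge0_integralD//=; last 4 first.
- by move=> t _; rewrite lee_fin sqr_ge0.
- by apply/measurable_EFinP; exact: measurable_funX.
- by move=> t _; rewrite lee_fin sqr_ge0.
- by apply/measurable_EFinP; exact: measurable_funX.
under eq_integral do rewrite -EFinD.
apply: ge0_le_integralT; [|exact: measurable_funX|].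
  by apply: measurable_funD; exact: measurable_funX.
move=> t; rewrite addr_ge0 ?sqr_ge0//=.
rewrite !patchE !mem_setE !in_itv/=; case: ifP => h1; case: ifP => h2.
- by move: h1 h2 => /andP[_ h1] /andP[h2 _]; lra.
- by rewrite expr0n addr0.
- by rewrite expr0n add0r.
- by rewrite expr0n addr0 sqr_ge0.
Qed.

Lemma norm2_restrict_le (D : set R) : measurable D -> norm2 (v \_ D) <= norm2 v.
Proof.
move=> mD; apply: norm2_ae_le => //; first exact: sq_int01_restrict.
apply/aeW => t; rewrite patchE; case: ifPn => // _.
by rewrite normr0.
Qed.

Lemma continuous_primitive : continuous primitive.
Proof.
have hoelder a b : a <= b ->
    (primitive b - primitive a) ^+ 2 <= (b - a) * norm2 v ^+ 2.
  move=> ab; apply: le_trans (primitive_dist_sqr _ _ ab) _.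
  rewrite ler_wpM2l ?subr_ge0// ler_pXn2r ?nnegrE ?seminorm_ge0//.
  by apply: norm2_restrict_le; exact: measurable_itv.
move=> t; apply/cvgrPdist_lt => e e0.
pose n := norm2 v ^+ 2 + 1.
have n0 : 0 < n by rewrite ltr_wpDl// sqr_ge0.
have d0 : 0 < e ^+ 2 / n by rewrite divr_gt0// exprn_gt0.
near=> s.
have ts : `|t - s| < e ^+ 2 / n by near: s; apply: cvgr_dist_lt d0; exact: cvg_id.
rewrite -(@ltr_pXn2r _ 2) ?nnegrE ?(ltW e0)// real_normK ?num_real//.
have : (primitive t - primitive s) ^+ 2 <= `|t - s| * norm2 v ^+ 2.
  have [st|/ltW ts'] := lerP s t.
    exact: hoelder.
  by rewrite -sqrrN opprB; exact: hoelder.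
move=> /le_lt_trans; apply; move: ts; rewrite ltr_pdivlMr// /n mulrDr mulr1.
by apply: le_lt_trans; rewrite lerDl.
Unshelve. all: by end_near. Qed.

End primitive.

Lemma primitive0 (w : R -> R) : sq_int01 w -> primitive w 0 = 0.
Proof.
move=> sw; rewrite /primitive -Rintegral_itv_bndo_bndc; last first.
  by apply: integrable_sub => //; exact: measurable_itv.
rewrite (@eq_Rintegral _ _ _ _ _ (cst 0)) => [|t].
  by rewrite /Rintegral integral0_eq.
rewrite inE/= in_itv/= => t0; case: sw => _ -> //.
by rewrite /I01/= in_itv/= leNgt t0.
Qed.

(** Hardy's inequality for a primitive, which vanishes at 0. *)
Lemma weighted_primitive (h : R -> R) (l : R) (w : R -> R) :
  measurable_fun [set: R] h -> (forall t, 0 <= h t) -> 0 <= l ->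
  (forall t, 0 < t < 1 -> (\int[mu]_(s in `[t, 1%R]) (h s)%:E <= (l / t)%:E)%E) ->
  sq_int01 w ->
  let f := (fun t => Num.sqrt (h t) * primitive w t) \_ I01 in
  sq_int01 f /\ norm2 f <= 2 * Num.sqrt l * norm2 w.
Proof.
move=> mh h0 l0 hl sw f; have [mw w0 _] := sw.
have mf : measurable_fun [set: R] f.
  have [+ _] := measurable_restrictT (fun t => Num.sqrt (h t) * primitive w t)
    (@measurable_I01 R); apply.
  apply: measurable_funTS; apply: measurable_funM.
    exact: measurableT_comp measurable_sqrtr mh.
  by apply: continuous_measurable_fun; exact: continuous_primitive.
have mi : measurable_fun [set: R * R] (\1_hardy_set : R * R -> R).
  by apply: measurable_indic; exact: measurable_hardy_set.
pose I t : \bar R := (\int[mu]_s (\1_hardy_set (t, s) * `|w s|)%:E)%E.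
have in0 z : 0 <= (\1_hardy_set z : R) by rewrite indicE.
have I0 t : (0 <= I t)%E by exact: section_integral_ge0.
have mI : measurable_fun [set: R] I.
  by apply: measurable_section_integral => //; exact: measurable_hardy_set.
have mabs (D : set R) : measurable_fun D (fun s => `|w s|%:E).
  by apply/measurable_funTS/measurable_EFinP; exact: measurableT_comp.
have pI t : 0 <= t <= 1 -> (`|primitive w t|%:E <= I t)%E.
  move=> /andP[t0 t1]; rewrite -[primitive w t]subr0 -(primitive0 _ sw).
  apply: le_trans (primitive_dist _ sw _ _ t0) _; rewrite integral_itv_bndoo//.
  rewrite [leLHS]integral_mkcond; apply: ge0_le_integral => //.
  - by move=> s _; rewrite patchE; case: ifP.
  - apply: measurable_patchT => //.
  - apply/measurable_EFinP; apply: measurable_funM; last exact: measurableT_comp.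
    exact: measurable_fun_pair2 mi.
  - move=> s _; rewrite patchE; case: ifPn => [|_]; last first.
      by rewrite lee_fin; exact: mulr_ge0.
    rewrite mem_setE in_itv/= => /andP[s0 st].
    by rewrite lee_fin indicE mem_set ?mul1r//; split=> /=; lra.
have fI t : ((f t ^+ 2)%:E <= (h t)%:E * (I t * I t))%E.
  rewrite /f patchE; case: ifPn => [|_]; last first.
    by rewrite expr0n mule_ge0 ?lee_fin//; exact: mule_ge0.
  rewrite /I01 mem_setE in_itv/= => /pI tI.
  rewrite exprMn sqr_sqrtr// EFinM; apply: lee_wpmul2l; first by rewrite lee_fin.
  by rewrite -(real_normK (num_real _)) expr2 EFinM; apply: lee_pmul.
have bound : (\int[mu]_t (f t ^+ 2)%:E <= ((2 * Num.sqrt l * norm2 w) ^+ 2)%:E)%E.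
  rewrite !exprMn sqr_sqrtr// (_ : 2 ^+ 2 = 4); last by ring.
  rewrite EFinM norm2_sqr//.
  apply: le_trans (weighted_hardy h l mh h0 l0 hl w mw).
  apply: ge0_le_integral => //.
  - by move=> t _; rewrite lee_fin sqr_ge0.
  - by apply/measurable_EFinP; exact: measurable_funX.
  - apply: emeasurable_funM; first exact/measurable_EFinP.
    exact: (emeasurable_funM mI mI).
have sf : sq_int01 f.
  split=> //; first by move=> t It; rewrite /f patchE memNset.
  exact: le_lt_trans bound (ltry _).
by split=> //; apply: norm2_le => //; rewrite !mulr_ge0 ?sqrtr_ge0 ?seminorm_ge0.
Qed.

End indefinite_integral.

(** * The slope of the solution of the linear problem *)

Section linear_problem.
Context {R : realType}.
Notation mu := (@lebesgue_measure R).
Notation norm2 := (@seminorm R (R -> R^o) L2ip).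

Lemma integral_sqr_restrict (f : R -> R) (D : set R) :
  (\int[mu]_t ((f \_ D) t ^+ 2)%:E = \int[mu]_(t in D) (f t ^+ 2)%:E)%E.
Proof.
rewrite [RHS]integral_mkcond; apply: eq_integral => t _; rewrite !patchE.
by case: ifPn => // _; rewrite expr0n.
Qed.

Lemma ae_neq (a : R) : {ae mu, forall t, t <> a}.
Proof.
exists [set a]; split; first exact: measurable_set1.
  exact: lebesgue_measure_set1.
by move=> t /= /contrapT.
Qed.

Lemma continuous_sq_int01 (f : R -> R) : continuous f -> sq_int01 (f \_ I01).
Proof.
move=> cf; have mI := @measurable_I01 R.
have mf : measurable_fun [set: R] f by exact: continuous_measurable_fun.
split.
- have [+ _] := measurable_restrictT f mI; apply; exact: measurable_funTS.
- by move=> t It; rewrite patchE memNset.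
- rewrite integral_sqr_restrict; apply: integrable_lty => //.
  apply: (@continuous_compact_integrable R (fun t => f t ^+ 2)).
    exact: segment_compact.
  rewrite (_ : (fun t => f t ^+ 2) = (fun t => f t * f t)).
    by apply: continuous_subspaceT => t; apply: cvgM; exact: cf.
  by apply/funext => t; rewrite expr2.
Qed.

Section slope.
Context (delta eta : R) (delta_neq1 : delta != 1) (eta01 : 0 < eta < 1).

(** The derivative of the function x with x'' = v, x 0 = 0 and
    x' 1 = delta * x' eta. *)
Definition slope (v : R -> R) (t : R) : R :=
  primitive v t + (primitive v 1 - delta * primitive v eta) / (delta - 1).

Lemma delta1_neq0 : delta - 1 != 0. Proof. by rewrite subr_eq0. Qed.

Lemma slope_boundary (v : R -> R) : slope v 1 = delta * slope v eta.
Proof. by rewrite /slope; field; exact: delta1_neq0. Qed.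

Lemma slopeB (v : R -> R) (s t : R) :
  slope v t - slope v s = primitive v t - primitive v s.
Proof. by rewrite /slope opprD addrACA subrr addr0. Qed.

(** For t <= eta the coefficients of the integrals over [t, eta] and [eta, 1]
    are -1 and 1 / (delta - 1), the values of the Green kernel. *)
Lemma slope_kernel (v : R -> R) (t : R) : slope v t =
  (primitive v t - primitive v eta) +
  (delta - 1)^-1 * (primitive v 1 - primitive v eta).
Proof. by rewrite /slope; field; exact: delta1_neq0. Qed.

Lemma continuous_slope (v : R -> R) : sq_int01 v -> continuous (slope v).
Proof.
move=> sv t; apply: cvgD; [exact: continuous_primitive|exact: cvg_cst].
Qed.

(** The Cauchy-Schwarz inequality for (p * sqrt s, q * sqrt r) and
    (sqrt a, sqrt b), without square roots. *)
Lemma sqr_lincomb_le (p q A B s r a b : R) :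
  0 <= s -> 0 <= r -> 0 <= a -> 0 <= b -> A ^+ 2 <= s * a -> B ^+ 2 <= r * b ->
  (p * A + q * B) ^+ 2 <= (p ^+ 2 * s + q ^+ 2 * r) * (a + b).
Proof.
move=> s0 r0 a0 b0 hA hB.
have p20 := sqr_ge0 p; have q20 := sqr_ge0 q.
have hpA := ler_wpM2l p20 hA; have hqB := ler_wpM2l q20 hB.
pose m := p ^+ 2 * (s * b); pose k := q ^+ 2 * (r * a).
have m0 : 0 <= m by apply: mulr_ge0 => //; exact: mulr_ge0.
have k0 : 0 <= k by apply: mulr_ge0 => //; exact: mulr_ge0.
have Zmk : (p * q * (A * B)) ^+ 2 <= m * k.
  rewrite (_ : m * k = (p ^+ 2 * (s * a)) * (q ^+ 2 * (r * b))); last first.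
    by rewrite /m /k; ring.
  rewrite (_ : _ ^+ 2 = (p ^+ 2 * A ^+ 2) * (q ^+ 2 * B ^+ 2)); last by ring.
  by apply: ler_pM => //; rewrite mulr_ge0// sqr_ge0.
have Zle : 2 * (p * q * (A * B)) <= m + k.
  rewrite (le_trans (ler_norm _))// -(@ler_pXn2r _ 2) ?nnegrE ?addr_ge0//.
  rewrite real_normK ?num_real// exprMn.
  have := sqr_ge0 (m - k); rewrite sqrrB sqrrD; lra.
rewrite sqrrD !exprMn.
rewrite (_ : _ * _ *+ 2 = 2 * (p * q * (A * B))); last by ring.
have -> : (p ^+ 2 * s + q ^+ 2 * r) * (a + b) =
    p ^+ 2 * (s * a) + q ^+ 2 * (r * b) + (m + k) by rewrite /m /k; ring.
lra.
Qed.

Lemma integral_affine_bound (f : R -> R) (a b m k : R) : a <= b ->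
  measurable_fun [set: R] f -> (forall s, ~ (a <= s <= b) -> f s = 0) ->
  (forall s, a <= s <= b -> 0 <= f s <= m * s + k) ->
  (\int[mu]_s (f s)%:E <=
    ((m / 2 * b ^+ 2 + k * b) - (m / 2 * a ^+ 2 + k * a))%:E)%E.
Proof.
move=> ab mf f0 fle.
apply: (@integral_le_primitive R f (fun s => m * s + k)
  (fun s => m / 2 * s ^+ 2 + k * s)) => // s _.
  by apply: is_derive_eq; rewrite /GRing.scale/=; field.
by apply: cvgD; [apply: cvgMr|exact: cvg_cst].
Qed.

(** Writing x' as the integral of v against the Green kernel of the boundary
    conditions, the Cauchy-Schwarz inequality bounds the L2 norm of x' by the
    Hilbert-Schmidt norm of that kernel, whose square is F(delta, eta). *)
Lemma slope_hilbert_schmidt (v : R -> R) : sq_int01 v ->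
  norm2 (slope v \_ I01) <= Num.sqrt (Fconst delta eta) * norm2 v.
Proof.
move=> sv; have [e0 e1] := andP eta01; have d1 := delta1_neq0.
have cs := continuous_slope _ sv; have sS := continuous_sq_int01 _ cs.
pose al := (delta - 1)^-1.
pose n := norm2 v ^+ 2.
have n0 : 0 <= n by exact: sqr_ge0.
(* Pointwise bounds by the integral of the squared kernel in s, which is
   affine in t on each side of eta. *)
have hL t : 0 <= t <= eta ->
    slope v t ^+ 2 <= ((eta - t) + al ^+ 2 * (1 - eta)) * n.
  move=> /andP[t0 te].
  have hA := primitive_dist_sqr _ sv _ _ te.
  have hB := primitive_dist_sqr _ sv _ _ (ltW e1).
  have hs := norm2_restrict_add _ sv _ _ _ te (ltW e1).
  have et : 0 <= eta - t by lra.
  have e1' : 0 <= 1 - eta by lra.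
  have := sqr_lincomb_le (-1) al _ _ _ _ _ _ et e1' (sqr_ge0 _) (sqr_ge0 _) hA hB.
  rewrite sqrrN expr1n mul1r (_ : -1 * _ + _ = slope v t); last first.
    by rewrite slope_kernel /al; ring.
  move=> /le_trans; apply.
  by rewrite ler_wpM2l// addr_ge0// mulr_ge0// sqr_ge0.
have hR t : eta <= t <= 1 ->
    slope v t ^+ 2 <= ((1 + al) ^+ 2 * (t - eta) + al ^+ 2 * (1 - t)) * n.
  move=> /andP[et t1].
  have hA := primitive_dist_sqr _ sv _ _ et.
  have hB := primitive_dist_sqr _ sv _ _ t1.
  have hs := norm2_restrict_add _ sv _ _ _ et t1.
  have et' : 0 <= t - eta by lra.
  have t1' : 0 <= 1 - t by lra.
  have := sqr_lincomb_le (1 + al) al _ _ _ _ _ _ et' t1'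
    (sqr_ge0 _) (sqr_ge0 _) hA hB.
  rewrite (_ : (1 + al) * _ + _ = slope v t); last first.
    by rewrite slope_kernel /al; ring.
  move=> /le_trans; apply.
  by rewrite ler_wpM2l// addr_ge0// mulr_ge0// sqr_ge0.
have FE : Fconst delta eta = eta ^+ 2 / 2 +
    (1 + al) ^+ 2 * (1 - eta) ^+ 2 / 2 + al ^+ 2 * (1 - eta ^+ 2) / 2.
  by rewrite /Fconst /al; field.
have F0 : 0 <= Fconst delta eta.
  rewrite FE; have e2 : 0 <= 1 - eta ^+ 2.
    by rewrite subr_ge0 expr_le1// ltW.
  apply: addr_ge0; last by rewrite divr_ge0// mulr_ge0// sqr_ge0.
  apply: addr_ge0; rewrite divr_ge0//; first exact: sqr_ge0.
  by rewrite mulr_ge0// sqr_ge0.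
have mS : measurable_fun [set: R] (slope v) by exact: continuous_measurable_fun.
have mSD (D : set R) : measurable D ->
    measurable_fun [set: R] (fun t => (slope v \_ D) t ^+ 2).
  move=> mD; apply: measurable_funX.
  have [+ _] := measurable_restrictT (slope v) mD; apply.
  exact: measurable_funTS.
have mL := mSD _ (measurable_itv `[0%R, eta]).
have mR := mSD _ (measurable_itv `]eta, 1%R]).
have bL := @integral_affine_bound _ 0 eta (- n) ((eta + al ^+ 2 * (1 - eta)) * n)
  (ltW e0) mL.
have bR := @integral_affine_bound _ eta 1 (((1 + al) ^+ 2 - al ^+ 2) * n)
  ((al ^+ 2 - (1 + al) ^+ 2 * eta) * n) (ltW e1) mR.
apply: norm2_le => //; first by rewrite mulr_ge0 ?sqrtr_ge0 ?seminorm_ge0.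
rewrite exprMn sqr_sqrtr// -/n.
apply: (@le_trans _ _ (\int[mu]_t ((slope v \_ `[0%R, eta]) t ^+ 2 +
    (slope v \_ `]eta, 1%R]) t ^+ 2)%:E)%E).
  apply: ge0_le_integralT.
  - by apply: measurable_funX; case: sS.
  - exact: measurable_funD.
  - move=> t; rewrite sqr_ge0/= !patchE /I01 !mem_setE !in_itv/=.
    case: ifPn => [/andP[t0 t1]|_]; last by rewrite expr0n addr_ge0// sqr_ge0.
    have [te|te] := lerP t eta.
      by rewrite t0/= lerDl sqr_ge0.
    by rewrite t0 t1/= expr0n add0r.
under eq_integral do rewrite EFinD.
rewrite ge0_integralD//=; last 4 first.
- by move=> t _; rewrite lee_fin sqr_ge0.
- exact/measurable_EFinP.
- by move=> t _; rewrite lee_fin sqr_ge0.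
- exact/measurable_EFinP.
apply: le_trans (leeD (bL _ _) (bR _ _)) _.
- by move=> t nt; rewrite patchE mem_setE in_itv/= ifF ?expr0n//; apply/negP.
- move=> t tI; rewrite sqr_ge0 patchE mem_setE in_itv/= tI.
  by apply: le_trans (hL _ tI) _; lra.
- move=> t nt; rewrite patchE mem_setE in_itv/= ifF ?expr0n//.
  by apply/negP => /andP[et t1]; apply: nt; rewrite ltW.
- move=> t tI; rewrite sqr_ge0 patchE mem_setE in_itv/=.
  have := hR _ tI; case: ifP => _ h; first by lra.
  by rewrite expr0n/=; have := le_trans (sqr_ge0 _) h; lra.
by rewrite -EFinD lee_fin FE; lra.
Qed.

(** If delta <= 0 then x' 1 and x' eta do not have the same sign, so x'
    vanishes somewhere. *)
Lemma slope_wirtinger (v : R -> R) : sq_int01 v -> delta <= 0 ->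
  norm2 (slope v \_ I01) <= 2 / pi * norm2 v.
Proof.
move=> sv d0; have [e0 e1] := andP eta01; have [mv _ _] := sv.
have cs := continuous_slope _ sv; have sS := continuous_sq_int01 _ cs.
have p2 : 0 <= 2 / pi :> R by rewrite divr_ge0// ltW// pi_gt0.
have [c] : exists2 c, c \in `[eta, 1] & slope v c = 0.
  apply: IVT; [exact: ltW|exact: continuous_subspaceT|].
  rewrite slope_boundary ge_min le_max.
  have [s0|/ltW s0] := leP 0 (slope v eta).
    by apply/andP; split; apply/orP; [right; exact: mulr_le0_ge0|left].
  by apply/andP; split; apply/orP; [left|right; exact: mulr_le0].
rewrite in_itv/= => /andP[ec c1] vc.
have Ic : I01 c by rewrite /I01/= in_itv/=; apply/andP; split; lra.
have mE := measurable_wirtinger_set c.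
have mi : measurable_fun [set: R * R] (\1_(wirtinger_set c) : R * R -> R).
  exact: measurable_indic.
pose I t : \bar R := (\int[mu]_s (\1_(wirtinger_set c) (t, s) * `|v s|)%:E)%E.
have sub t (D : set R) : measurable D ->
    (forall s, D s -> wirtinger_set c (t, s)) ->
    (\int[mu]_(s in D) `|v s|%:E <= I t)%E.
  move=> mD h; rewrite [leLHS]integral_mkcond; apply: ge0_le_integral => //.
  - by move=> s _; rewrite patchE; case: ifP.
  - apply: measurable_patchT => //; apply/measurable_EFinP.
    exact: measurableT_comp.
  - apply/measurable_EFinP; apply: measurable_funM; last exact: measurableT_comp.
    exact: measurable_fun_pair2 mi.
  - move=> s _; rewrite patchE; case: ifPn => [/set_mem/h Es|_].
      by rewrite lee_fin indicE mem_set// mul1r.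
    by rewrite lee_fin mulr_ge0// indicE.
have mabs (D : set R) : measurable_fun D (fun s => `|v s|%:E).
  by apply/measurable_funTS/measurable_EFinP; exact: measurableT_comp.
have sI t : 0 < t < 1 -> (`|slope v t|%:E <= I t)%E.
  move=> /andP[t0 t1]; rewrite -[slope v t]subr0 -vc slopeB.
  have [ct|tc] := lerP c t.
    apply: le_trans (primitive_dist _ sv _ _ ct) _; apply: sub => // s.
    by rewrite /= in_itv/= => /andP[cs' st]; left; split=> //=; exact: ltW.
  rewrite distrC; apply: le_trans (primitive_dist _ sv _ _ (ltW tc)) _.
  rewrite integral_itv_bndoo//; apply: sub => // s.
  by rewrite /= in_itv/= => /andP[ts sc]; right; split=> //=; exact: ltW.
apply: norm2_le => //; first by rewrite mulr_ge0 ?seminorm_ge0.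
rewrite exprMn EFinM norm2_sqr//.
apply: le_trans (wirtinger _ _ Ic mv).
have mI : measurable_fun [set: R] I by exact: measurable_section_integral.
have I0 t : (0 <= I t)%E by exact: section_integral_ge0.
apply: ae_ge0_le_integral => //.
- by move=> t _; rewrite lee_fin sqr_ge0.
- by apply/measurable_EFinP; apply: measurable_funX; case: sS.
- by move=> t _; exact: (mule_ge0 (I0 t) (I0 t)).
- exact: (emeasurable_funM mI mI).
have := lebesgue_aeI _ _ (ae_neq 0) (ae_neq 1).
apply: lebesgue_aeS => t [t0 t1] _.
rewrite patchE; case: ifPn => [|_]; last first.
  by rewrite expr0n; exact: (mule_ge0 (I0 t) (I0 t)).
rewrite /I01 mem_setE in_itv/= => /andP[t0' t1'].
have /sI tI : 0 < t < 1.
  have [{}t0 {}t1] : t != 0 /\ t != 1 by split; apply/eqP.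
  by rewrite !lt_neqAle t0' t1' !andbT eq_sym t0. 
rewrite -(real_normK (num_real _)) expr2 EFinM.
by apply: lee_pmul.
Qed.

Lemma slope_norm_le (v : R -> R) : sq_int01 v ->
  norm2 (slope v \_ I01) <= Cconst delta eta * norm2 v.
Proof.
move=> sv; have hs := slope_hilbert_schmidt _ sv.
rewrite /Cconst; case: ifPn => [d0|_] //.
by rewrite /Num.min; case: ifP => _ //; exact: slope_wirtinger.
Qed.

End slope.

End linear_problem.

(** * Borel representatives of Lebesgue measurable functions *)

Section borel_representative.
Context {R : realType}.
Notation mu := (@lebesgue_measure R).
Notation norm2 := (@seminorm R (R -> R^o) L2ip).

Notation cmu := (@completed_lebesgue_measure R).
Notation completed_measurable := ((@wlength R idfun)^*%mu.-cara.-measurable).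
Notation completed_real := (caratheodory_type (@wlength R idfun)^*%mu).

Lemma lebesgue_null_ae (M : set R) (P : R -> Prop) : measurable M ->
  mu M = 0%E -> (forall t, ~ M t -> P t) -> {ae mu, forall t, P t}.
Proof.
move=> mM M0 MP; exists M; split=> // t /= nP; apply: contrapT => nM.
exact/nP/MP.
Qed.

Lemma borel_completed (A : set R) : measurable A -> completed_measurable A.
Proof. exact: sub_caratheodory. Qed.

Lemma completed_measurable_borel (A : set R) : completed_measurable A ->
  exists B M : set R, [/\ measurable B, measurable M, mu M = 0%E &
    forall t, ~ M t -> (A t <-> B t)].
Proof.
rewrite -completed_caratheodory_measurable g_sigma_completed_algebra_genE.
move=> [B mB [N [M [mM M0 NM]] <-]]; exists B, M; split=> // t nM; split.
  by move=> [//|/NM].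
by left.
Qed.

Lemma ae_completed (P : R -> Prop) : {ae mu, forall t, P t} ->
  {ae cmu, forall t, P t}.
Proof.
move=> [M [mM M0 PM]]; exists M; split=> //.
exact: borel_completed.
Qed.

(** A Lebesgue measurable function agrees with a Borel function off a Borel
    null set, which absorbs the countably many null sets on which its rational
    superlevel sets fail to be Borel. *)
Lemma borel_modification (D : set R) (f : R -> R) : measurable D ->
  measurable_fun (D : set completed_real) f ->
  exists f' M, [/\ measurable_fun [set: R] (f' : R -> R), measurable (M : set R),
    mu M = 0%E, forall t, D t -> ~ M t -> f' t = f t &
    forall t, ~ (D t /\ ~ M t) -> f' t = 0].
Proof.
move=> mD mf.
pose q n : R := ratr (odflt 0%Q (unpickle n)).
have q_dense (x y : R) : x < y -> exists n, x < q n < y.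
  move=> /rat_in_itvoo[r]; rewrite in_itv/= => rxy.
  by exists (pickle r); rewrite /q pickleK.
have level n : exists BM : set R * set R, [/\ measurable BM.1,
    measurable BM.2, mu BM.2 = 0%E &
    forall t, ~ BM.2 t -> ((D t /\ q n < f t) <-> BM.1 t)].
  have mA : completed_measurable (D `&` f @^-1` `]q n, +oo[).
    by apply: mf => //; exact: borel_completed.
  have [B [M [mB mM M0 BM]]] := completed_measurable_borel _ mA.
  exists (B, M); split=> //= t nM; rewrite -BM//; split.
    by move=> [Dt qt]; split=> //=; rewrite in_itv/= andbT.
  by move=> [Dt /=]; rewrite in_itv/= andbT.
have [BM hBM] := choice level.
pose M := \bigcup_n (BM n).2.
have mM : measurable M by apply: bigcupT_measurable => n; case: (hBM n).
have M0 : mu M = 0%E.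
  have [+ _] := @negligibleP _ _ _ mu M mM; apply.
  apply: negligible_bigcup => n; have [_ mn n0 _] := hBM n.
  by have [_ +] := @negligibleP _ _ _ mu _ mn; apply.
have mDM : measurable (D `\` M) by exact: measurableD.
exists (f \_ (D `\` M)), M; split=> //.
- have [+ _] := measurable_restrictT f mDM; apply.
  apply: (measurability _ (RGenOInfty.measurableE R)) => // _ [_ [x ->] <-].
  rewrite (_ : _ `&` _ = (D `\` M) `&`
      \bigcup_(n in [set n | x < q n]) (BM n).1).
    apply: measurableI => //; apply: bigcup_measurable => n _.
    by case: (hBM n).
  apply/seteqP; split=> t /=.
    move=> [[Dt nMt]]; rewrite in_itv/= andbT => xt; split=> //.
    have [n /andP[xq qt]] := q_dense _ _ xt.
    exists n => //; have [_ _ _ hn] := hBM n.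
    by apply/hn => // Mt; apply: nMt; exists n.
  move=> [[Dt nMt] [n /= xq Bt]]; split=> //; rewrite in_itv/= andbT.
  have [_ _ _ hn] := hBM n.
  have /hn[_ /(_ Bt)[_]] : ~ (BM n).2 t by move=> Mt; apply: nMt; exists n.
  exact: lt_trans.
- by move=> t Dt nM; rewrite patchE mem_set.
- by move=> t nDM; rewrite patchE memNset.
Qed.

(** Lebesgue measure on Borel sets is the image of its completion under the
    identity. *)
Lemma completed_integral (D : set R) (f : R -> \bar R) : measurable D ->
  measurable_fun D f -> (forall t, D t -> (0 <= f t)%E) ->
  (\int[cmu]_(t in D) f t = \int[mu]_(t in D) f t)%E.
Proof.
move=> mD mf f0.
have mid : measurable_fun [set: completed_real]
    (idfun : completed_real -> measurableTypeR R).
  by move=> _ A mA; rewrite setTI; exact: borel_completed.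
transitivity (\int[pushforward cmu
    (idfun : completed_real -> measurableTypeR R)]_(t in D) f t)%E.
  rewrite (ge0_integral_pushforward mid)// => t; rewrite inE; exact: f0.
by apply: eq_measure_integral.
Qed.

Lemma completed_integral_modification (D M : set R) (f f' : R -> R) :
  measurable D -> measurable M -> mu M = 0%E ->
  measurable_fun (D : set completed_real) f -> measurable_fun [set: R] f' ->
  (forall t, D t -> 0 <= f t) -> (forall t, D t -> 0 <= f' t) ->
  (forall t, D t -> ~ M t -> f' t = f t) ->
  (\int[cmu]_(t in D) (f t)%:E = \int[mu]_(t in D) (f' t)%:E)%E.
Proof.
move=> mD mM M0 mf mf' f0 f'0 ff'.
have mf'D : measurable_fun D (fun t => (f' t)%:E).
  by apply: measurable_funTS; exact/measurable_EFinP.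
rewrite -completed_integral//.
apply: ge0_ae_eq_integral.
- exact: borel_completed.
- exact/measurable_EFinP.
- by move=> _ A mA; apply: borel_completed; exact: mf'D.
- by move=> t Dt; rewrite lee_fin; exact: f0.
- by move=> t Dt; rewrite lee_fin; exact: f'0.
apply: ae_completed; apply: (lebesgue_null_ae M) => // t nM Dt.
by rewrite ff'.
Qed.

(** Weights in Z(l) are only Lebesgue measurable, while Schur's test exchanges
    integrals of Borel functions. *)
Lemma Zclass_borel (l : R) (k : R -> R) : Zclass l (fun t => k t ^+ 2) ->
  exists (h : R -> R) (M : set R), [/\ measurable_fun [set: R] h,
    forall t, 0 <= h t, measurable M, mu M = 0%E &
    (forall t, 0 < t <= 1 -> ~ M t -> h t = k t ^+ 2) /\
    (forall t, 0 < t < 1 -> (\int[mu]_(s in `[t, 1%R]) (h s)%:E <= (l / t)%:E)%E)].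
Proof.
move=> [k0 kint ktail].
have mD : measurable (`]0%R, 1%R] : set R) by exact: measurable_itv.
have mk : measurable_fun (`]0%R, 1%R]%classic : set completed_real)
    (fun t => k t ^+ 2).
  pose F n : set completed_real := `[n.+1%:R^-1, 1%R]%classic.
  have UF : \bigcup_n F n = `]0%R, 1%R]%classic.
    apply/seteqP; split=> s.
      move=> [n _]; rewrite /F/= !in_itv/= => /andP[ns ->]; rewrite andbT.
      by rewrite (lt_le_trans _ ns)// invr_gt0.
    rewrite /= in_itv/= => /andP[s0 st].
    have [n _ /(_ n (leqnn n)) hn] := near_infty_natSinv_lt (PosNum s0).
    by exists n => //; rewrite /F/= in_itv/= st andbT ltW.
  rewrite -UF; apply/measurable_fun_bigcup => n.
    by apply: borel_completed; exact: measurable_itv.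
  have n0 : 0 < n.+1%:R^-1 :> R by rewrite invr_gt0.
  have n1 : n.+1%:R^-1 <= 1 :> R by rewrite invf_le1// ler1n.
  have /integrableP[+ _] := kint _ _ n0 n1 (lexx 1).
  by move/measurable_EFinP.
have [h [M [mh mM M0 hk h0]]] := borel_modification _ _ mD mk.
have hge0 t : 0 <= h t.
  have [[Dt nM]|nDM] := pselect (`]0%R, 1%R]%classic t /\ ~ M t).
    by rewrite hk// sqr_ge0.
  by rewrite h0.
exists h, M; split=> //; split=> [t t01 nM|t /[dup] t01 /andP[t0 t1]].
  by rewrite hk//= in_itv.
apply: le_trans (ktail _ t01).
have sub : `[t, 1%R]%classic `<=` (`]0%R, 1%R]%classic : set R).
  by move=> s; rewrite /= !in_itv/= => /andP[ts ->]; rewrite (lt_le_trans t0).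
have mks : measurable_fun (`[t, 1%R]%classic : set completed_real)
    (fun s => k s ^+ 2).
  by apply: measurable_funS mk; [exact: borel_completed|exact: sub].
have E := completed_integral_modification _ M (fun t => k t ^+ 2) h
  (measurable_itv `[t, 1%R]) mM M0 mks mh.
rewrite -{}E.
- exact: lexx.
- by move=> s _; exact: sqr_ge0.
- by move=> s _; exact: hge0.
- by move=> s /sub Ds nM; exact: hk.
Qed.

Lemma L2_01_borel (a : R -> R) : L2_01 a ->
  exists (a' : R -> R) (M : set R), [/\ sq_int01 a', measurable M, mu M = 0%E &
    forall t, I01 t -> ~ M t -> a' t = a t].
Proof.
move=> La.
have La' : (a \_ I01 : completed_real -> R) \in Lfun cmu 2%:E by exact: La.
have mI := @measurable_I01 R; have mIc := borel_completed _ mI.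
have ma : measurable_fun (I01 : set completed_real) a.
  apply/(measurable_restrictT (a : completed_real -> R) mIc).
  by have := sub_Lfun_mfun La'; rewrite inE.
have [a' [M [ma' mM M0 aa' a'0]]] := borel_modification _ _ mI ma.
exists a', M; split=> //; split=> //.
  by move=> t It; apply: a'0 => -[].
have /integrable_lty := Lfun2_integrable_sqr La'; move=> /(_ measurableT).
have -> : (\int[mu]_t (a' t ^+ 2)%:E = \int[mu]_(t in I01) (a' t ^+ 2)%:E)%E.
  rewrite [RHS]integral_mkcond; apply: eq_integral => t _; rewrite patchE.
  by case: ifPn => // /negP; rewrite inE => It; rewrite a'0 ?expr0n// => -[].
have E := completed_integral_modification _ M (fun t => a t ^+ 2)
  (fun t => a' t ^+ 2) mI mM M0 (measurable_funX 2 ma) (measurable_funX 2 ma').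
rewrite -{}E.
- rewrite [X in _ -> (X < _)%E]integral_mkcond => fin.
  rewrite (_ : _ \_ _ = EFin \o (fun t => (a \_ I01) t ^+ 2))//.
  by apply/funext => t; rewrite /= !patchE; case: ifP => // _; rewrite expr0n.
- by move=> t _; exact: sqr_ge0.
- by move=> t _; exact: sqr_ge0.
- by move=> t It nM; rewrite aa'.
Qed.

(** Measurability passes to functions equal almost everywhere because the
    measure is complete. *)
Lemma sq_int01_L2_01 (v f : R -> R) : sq_int01 v ->
  {ae mu, forall t, I01 t -> f t = v t} -> L2_01 f.
Proof.
move=> sv fv; have [mv v0 vfin] := sv.
have vf : ae_eq cmu [set: completed_real] (EFin \o v) (EFin \o (f \_ I01)).
  apply: ae_completed; apply: lebesgue_aeS fv => t ft _ /=.
  rewrite patchE; case: ifPn => [|/negP]; rewrite inE => It; first by rewrite ft.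
  by rewrite v0.
have mvc : measurable_fun [set: completed_real] (v : completed_real -> R).
  by move=> _ A mA; apply: borel_completed; exact: mv.
have mf : measurable_fun [set: completed_real] (f \_ I01 : completed_real -> R).
  apply/measurable_EFinP.
  apply: (ae_measurable_fun completed_lebesgue_measure_is_complete vf).
  exact/measurable_EFinP.
suff : (f \_ I01 : completed_real -> R) \in Lfun cmu 2%:E by exact.
rewrite inE; apply/andP; split; rewrite inE//=.
rewrite /finite_norm unlock /= poweR_lty//.
rewrite (_ : integral _ _ _ = (\int[cmu]_t ((f \_ I01) t ^+ 2)%:E)%E); last first.
  apply: eq_integral => t _ /=.
  rewrite -[LHS]/((`|(f \_ I01) t| `^ 2%:R)%R%:E) powR_mulrn//.
  by rewrite real_normK// num_real.
have -> : (\int[cmu]_t ((f \_ I01) t ^+ 2)%:E = \int[cmu]_t (v t ^+ 2)%:E)%E.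
  apply: ge0_ae_eq_integral.
  - exact: measurableT.
  - by apply/measurable_EFinP; exact: measurable_funX.
  - by apply/measurable_EFinP; exact: measurable_funX.
  - by move=> t _; rewrite lee_fin sqr_ge0.
  - by move=> t _; rewrite lee_fin sqr_ge0.
  case: vf => M [mM M0 h]; exists M; split=> // t /= nt; apply: h => /= e.
  by apply: nt => _; have [<-] := e I.
rewrite completed_integral// => [|t _]; last by rewrite lee_fin sqr_ge0.
by apply/measurable_EFinP; exact: measurable_funX.
Qed.

End borel_representative.

(** * The superposition operator *)

Section superposition_operator.
Context {R : realType}.
Notation mu := (@lebesgue_measure R).
Notation norm2 := (@seminorm R (R -> R^o) L2ip).

Lemma norm2D (v w : R -> R) : sq_int01 v -> sq_int01 w ->
  norm2 (v \+ w) <= norm2 v + norm2 w.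
Proof. exact: (seminormD L2_pre_hilbert). Qed.

Lemma norm2Z (a : R) (v : R -> R) : sq_int01 v ->
  norm2 (fun t => a * v t) = `|a| * norm2 v.
Proof. exact: (seminormZ L2_pre_hilbert). Qed.

Lemma primitive_sub (v w : R -> R) (t : R) : sq_int01 v -> sq_int01 w ->
  primitive (v \- w) t = primitive v t - primitive w t.
Proof.
move=> sv sw; rewrite /primitive RintegralB//.
- by apply: integrable_sub => //; exact: measurable_itv.
- by apply: integrable_sub => //; exact: measurable_itv.
Qed.

Lemma slope_sub (delta eta : R) (v w : R -> R) (t : R) :
  sq_int01 v -> sq_int01 w ->
  slope delta eta (v \- w) t = slope delta eta v t - slope delta eta w t.
Proof. by move=> sv sw; rewrite /slope !primitive_sub//; ring. Qed.

(** As G is Lipschitz in its second argument, the superlevel sets are countable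
    unions over rational values c of sets involving only G ^~ c and v. *)
Lemma measurable_lipschitz_comp (G : R -> R -> R) (K : R) (v : R -> R) :
  0 <= K -> (forall c, measurable_fun [set: R] (G ^~ c)) ->
  (forall t a b, `|G t a - G t b| <= K * `|a - b|) ->
  measurable_fun [set: R] v -> measurable_fun [set: R] (fun t => G t (v t)).
Proof.
move=> K0 mG lipG mv.
pose q n : R := ratr (odflt 0%Q (unpickle n)).
have q_dense (x y : R) : x < y -> exists n, x < q n < y.
  move=> /rat_in_itvoo[r]; rewrite in_itv/= => rxy.
  by exists (pickle r); rewrite /q pickleK.
apply: (measurability _ (RGenOInfty.measurableE R)) => // _ [_ [x ->] <-].
rewrite setTI (_ : _ @^-1` _ = \bigcup_k \bigcup_n
    ([set t | x + K * k.+1%:R^-1 < G t (q n)] `&`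
     [set t | `|v t - q n| < k.+1%:R^-1])).
  apply: bigcupT_measurable => k; apply: bigcupT_measurable => n.
  have lt_set (f1 f2 : R -> R) : measurable_fun [set: R] f1 ->
      measurable_fun [set: R] f2 -> measurable [set t | f1 t < f2 t].
    move=> m1 m2; rewrite -[X in measurable X]setTI.
    have := measurable_fun_ltr m1 m2 measurableT (Y := [set true]) I.
    by congr measurable; apply/seteqP; split=> z /=.
  apply: measurableI; apply: lt_set => //.
  by apply: measurableT_comp => //; exact: measurable_funB.
apply/seteqP; split=> t /=; rewrite in_itv/= andbT; last first.
  move=> [k _ [n _ [/= xG vq]]].
  move: (k.+1%:R^-1 : R) xG vq => e xG vq.
  have lip := le_trans (ler_norm _) (lipG t (q n) (v t)).
  rewrite (distrC (q n)) in lip.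
  have : K * `|v t - q n| <= K * e by rewrite ler_wpM2l// ltW.
  by lra.
move=> xG.
have d0 : 0 < (G t (v t) - x) / (2 * K + 1).
  by rewrite divr_gt0 ?subr_gt0// ltr_wpDl// mulr_ge0.
have [k _ /(_ k (leqnn k)) /= hk] := near_infty_natSinv_lt (PosNum d0).
have k0 : 0 < k.+1%:R^-1 :> R by rewrite invr_gt0.
have [n /andP[qn1 qn2]] : exists n, v t - k.+1%:R^-1 < q n < v t.
  by apply: q_dense; rewrite gtrBl.
exists k => //; exists n => //.
move: (k.+1%:R^-1 : R) k0 hk qn1 qn2 => e e0 hk qn1 qn2.
split=> /=; last by rewrite gtr0_norm; lra.
have vq : `|v t - q n| <= e by rewrite gtr0_norm; lra.
have lip := le_trans (lipG t (v t) (q n)) (ler_wpM2l K0 vq).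
have := le_trans (ler_norm _) lip.
have {}hk : e * (2 * K + 1) < G t (v t) - x.
  by rewrite -ltr_pdivlMr// ltr_wpDl// mulr_ge0.
lra.
Qed.

Section operator.
Context (g : R -> R -> R -> R -> R) (delta eta : R).
Context (delta_neq1 : delta != 1) (eta01 : 0 < eta < 1).
Notation slope := (slope delta eta).
Notation position v := (primitive (slope v \_ I01)).

(** The right-hand side of the equation as an operator on the second derivative:
    position v and slope v are the function x with x'' = v that satisfies the
    boundary conditions, and its derivative. *)
Definition superposition (v : R -> R) : R -> R :=
  (fun t => g t (position v t) (slope v t) (v t)) \_ I01.

Lemma sq_int01_slope (v : R -> R) : sq_int01 v -> sq_int01 (slope v \_ I01).
Proof. by move=> sv; apply: continuous_sq_int01; exact: continuous_slope. Qed.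

Lemma position_sub (v w : R -> R) (t : R) : sq_int01 v -> sq_int01 w ->
  position (v \- w) t = position v t - position w t.
Proof.
move=> sv sw; rewrite -primitive_sub; try exact: sq_int01_slope.
congr (primitive _ t); apply/funext => s /=.
rewrite !patchE; case: ifP => _; last by rewrite subr0.
exact: slope_sub.
Qed.

(** The linear growth estimate behind both hypotheses: the weight of x costs
    2 * sqrt l by Hardy's inequality, the norm of x' is at most C times that
    of x''. *)
Lemma majorant_norm_le (l K2 K3 : R) (k f d a : R -> R) : 0 <= l ->
  Zclass l (fun t => k t ^+ 2) -> 0 <= K2 -> 0 <= K3 ->
  sq_int01 d -> sq_int01 a -> measurable_fun [set: R] f ->
  (forall t, ~ I01 t -> f t = 0) ->
  {ae mu, forall t, I01 t -> `|f t| <= k t * `|position d t| +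
    K2 * `|slope d t| + K3 * `|d t| + a t} ->
  sq_int01 f /\ norm2 f <=
    ((2 * Num.sqrt l + K2) * Cconst delta eta + K3) * norm2 d + norm2 a.
Proof.
move=> l0 Zk K20 K30 sd sa mf f0 fle.
have [h [M [mh h0 mM M0 [hk htail]]]] := Zclass_borel _ _ Zk.
have sY := sq_int01_slope _ sd.
have [sP nP] := weighted_primitive h l _ mh h0 l0 htail sY.
move: sP nP; set P := (_ \_ I01) => sP nP.
set Y := slope d \_ I01 in sY nP.
have aP := sq_int01_norm _ sP; have aY := sq_int01Z K2 _ (sq_int01_norm _ sY).
have ad := sq_int01Z K3 _ (sq_int01_norm _ sd); have aa := sq_int01_norm _ sa.
have s1 := sq_int01D _ _ aP aY; have s2 := sq_int01D _ _ s1 ad.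
have s3 := sq_int01D _ _ s2 aa.
set m := (_ \+ (fun t => `|a t|)) in s3.
have nm : norm2 m <= norm2 P + K2 * norm2 Y + K3 * norm2 d + norm2 a.
  apply: le_trans (norm2D _ _ s2 aa) _; rewrite (norm2_norm a) lerD2r.
  apply: le_trans (norm2D _ _ s1 ad) _.
  rewrite (norm2Z _ _ (sq_int01_norm _ sd)) (norm2_norm d) (ger0_norm K30) lerD2r.
  apply: le_trans (norm2D _ _ aP aY) _.
  rewrite (norm2Z _ _ (sq_int01_norm _ sY)) (norm2_norm Y) (ger0_norm K20).
  by rewrite (norm2_norm P).
have fm : {ae mu, forall t, `|f t| <= `|m t|}.
  have aeM : {ae mu, forall t, ~ M t} by apply: (lebesgue_null_ae M).
  have := lebesgue_aeI _ _ fle (lebesgue_aeI _ _ aeM (ae_neq 0)).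
  apply: lebesgue_aeS => t [ft [nM tn0]].
  have [It|It] := pselect (I01 t); last by rewrite f0// normr0.
  apply: le_trans (ft It) _; apply: le_trans _ (ler_norm _).
  rewrite /m/= /P /Y !patchE mem_set// normrM (ger0_norm (sqrtr_ge0 _)).
  have t01 : 0 < t <= 1.
    move: It; rewrite /I01/= in_itv/= => /andP[t0 ->]; rewrite andbT.
    by rewrite lt_neqAle t0 andbT eq_sym; apply/eqP.
  rewrite hk// sqrtr_sqr; apply: lerD; last exact: ler_norm.
  by rewrite !lerD2r ler_wpM2r// ler_norm.
split; first exact: sq_int01_ae_le fm.
have sf := sq_int01_ae_le _ _ mf f0 s3 fm.
apply: le_trans (norm2_ae_le _ _ sf s3 fm) _; apply: le_trans nm _.
rewrite lerD2r mulrDl lerD2r.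
have nY : norm2 Y <= Cconst delta eta * norm2 d by exact: slope_norm_le.
have : (2 * Num.sqrt l + K2) * norm2 Y <=
    (2 * Num.sqrt l + K2) * (Cconst delta eta * norm2 d).
  by rewrite ler_wpM2l// addr_ge0// mulr_ge0// sqrtr_ge0.
by rewrite mulrA mulrDl; lra.
Qed.

Context (g_cont : {within I01 `*` [set: R * R * R],
     continuous (fun p : R * (R * R * R) => g p.1 p.2.1.1 p.2.1.2 p.2.2)}).

(** For a constant in place of v t the argument of g is continuous in t, and the
    dependence on v t is Lipschitz. *)
Lemma measurable_superposition (K : R) (v : R -> R) : 0 <= K ->
  (forall t a b c d, I01 t -> `|g t a b c - g t a b d| <= K * `|c - d|) ->
  sq_int01 v -> measurable_fun [set: R] (superposition v).
Proof.
move=> K0 lipg sv; have sY := sq_int01_slope _ sv.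
pose G t c := if t \in I01 then g t (position v t) (slope v t) c else 0.
have -> : superposition v = (fun t => G t (v t)).
  by apply/funext => t; rewrite /superposition patchE.
apply: (@measurable_lipschitz_comp G K) => //; last by case: sv.
  move=> c; pose Gc t := g t (position v t) (slope v t) c.
  have -> : G ^~ c = Gc \_ I01 by apply/funext => t; rewrite patchE.
  have [+ _] := measurable_restrictT Gc (@measurable_I01 R); apply.
  apply: subspace_continuous_measurable_fun; first exact: measurable_I01.
  apply/subspace_continuousP => t It.
  pose phi t : R * (R * R * R) := (t, (position v t, slope v t, c)).
  have cphi : phi s @[s --> t] --> phi t.
    have c1 : position v s @[s --> t] --> position v t.
      exact: continuous_primitive.
    have c2 : slope v s @[s --> t] --> slope v t by exact: continuous_slope.
    have c3 : (fun=> c) s @[s --> t] --> c by exact: cvg_cst.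
    exact: (cvg_pair (@cvg_id _ (nbhs t)) (cvg_pair (cvg_pair c1 c2) c3)).
  have Bphi s : I01 s -> (I01 `*` [set: R * R * R]) (phi s) by move=> Is; split.
  have := (subspace_continuousP _ _).1 g_cont (phi t) (Bphi t It).
  move=> gphi U /gphi; rewrite /= !nbhs_simpl/= /within/= => /cphi.
  by rewrite /= nbhs_simpl/=; apply: filterS => s hs Is; exact/hs/Bphi.
move=> t a b; rewrite /G; case: ifPn => [/set_mem It|_]; first exact: lipg.
by rewrite subrr normr0 mulr_ge0.
Qed.

End operator.

End superposition_operator.

(** * Differentiation on the unit interval *)

Section differentiation.
Context {R : realType}.
Notation mu := (@lebesgue_measure R).
Notation norm2 := (@seminorm R (R -> R^o) L2ip).

(** The increments are controlled by the Cauchy-Schwarz inequality on each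
    interval, then summed with the help of 2 * x * y <= k * x ^ 2 + y ^ 2 / k. *)
Lemma primitive_absolutely_continuous (w : R -> R) : sq_int01 w ->
  absolutely_continuous01 (primitive w).
Proof.
move=> sw e e0; have [mw _ _] := sw.
pose n := norm2 w ^+ 2; have n0 : 0 <= n by exact: sqr_ge0.
(* This value makes n / k < e, where n bounds the sum of the local norms. *)
pose k := (n + 1) / e; have k0 : 0 < k by rewrite divr_gt0// ltr_wpDl.
exists (e / k) => [|N a b ab tI small]; first by rewrite divr_gt0.
have aLb : forall i, a i <= b i.
  by move=> i; case: (ab i).
pose Q i := norm2 (w \_ `]a i, b i]) ^+ 2.
have amgm i : `|primitive w (b i) - primitive w (a i)| <=
    (k * (b i - a i) + Q i / k) / 2.
  have D := primitive_dist_sqr _ sw _ _ (aLb i).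
  have dba : 0 <= b i - a i by rewrite subr_ge0.
  have Qi : 0 <= Q i by exact: sqr_ge0.
  have rhs0 : 0 <= (k * (b i - a i) + Q i / k) / 2.
    apply: divr_ge0 => //.
    by apply: addr_ge0; [apply: mulr_ge0|apply: divr_ge0] => //; exact: ltW.
  rewrite -(@ler_pXn2r _ 2) ?nnegrE//.
  rewrite real_normK ?num_real//; apply: le_trans D _; rewrite -/(Q i).
  have := sqr_ge0 (k * (b i - a i) - Q i / k).
  have -> : (b i - a i) * Q i = (k * (b i - a i)) * (Q i / k).
    by field; rewrite gt_eqF.
  by rewrite expr_div_n sqrrB sqrrD; lra.
have sumQ : \sum_(i < N) Q i <= n.
  have mF (j : 'I_N) : measurable (`]a j, b j[%classic : set R).
    exact: measurable_itv.
  have mw2 (D : set R) : measurable_fun D (fun t => (w t ^+ 2)%:E).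
    by apply/measurable_funTS/measurable_EFinP; exact: measurable_funX.
  rewrite -lee_fin -sumEFin /n norm2_sqr//.
  apply: (@le_trans _ _ (\sum_(i < N) \int[mu]_(t in `]a i, b i[) (w t ^+ 2)%:E)%E).
    apply: lee_sum => i _; rewrite norm2_sqr; last first.
      by apply: sq_int01_restrict => //; exact: measurable_itv.
    by rewrite integral_sqr_restrict integral_itv_bndoo.
  pose F (i : 'I_N) : set (measurableTypeR R) := `]a i, b i[%classic.
  have E := @ge0_integral_bigsetU _ _ _ mu _ F (fun t => (w t ^+ 2)%:E)
    (index_enum _) mF (index_enum_uniq _).
  rewrite -E//.
  - apply: ge0_subset_integral => //.
    + by apply: bigsetU_measurable => j _; exact: mF.
    + exact: mw2.
    + by move=> t _; rewrite lee_fin sqr_ge0.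
  - by apply: sub_trivIset tI.
  - exact: mw2.
  - by move=> t _; rewrite lee_fin sqr_ge0.
apply: (@le_lt_trans _ _ (\sum_(i < N) (k * (b i - a i) + Q i / k) / 2)).
  by apply: ler_sum => i _; exact: amgm.
rewrite -mulr_suml big_split/= -mulr_sumr -mulr_suml.
have s1 : k * \sum_(i < N) (b i - a i) < e by rewrite mulrC -ltr_pdivlMr.
have s2 : (\sum_(i < N) Q i) / k < e.
  by rewrite ltr_pdivrMr// /k mulrC divfK ?gt_eqF//; lra.
by rewrite ltr_pdivrMr//; lra.
Qed.

(** No point of [0, 1] is isolated in it, so the limits that define derivatives
    on [0, 1], one-sided at the ends, are unique. *)
Lemma within_dnbhs_proper (t : R) : I01 t -> ProperFilter (within I01 t^').
Proof.
rewrite /I01/= in_itv/= => /andP[t0 t1].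
apply: Build_ProperFilter_ex => U; rewrite /within/= => /nbhs_ballP[e /= e0 h].
have [e2 [e20 e2e e21]] : exists e2, [/\ 0 < e2, e2 < e & e2 <= 2^-1 :> R].
  exists (Num.min (e / 2) 2^-1); split.
  - by rewrite lt_min divr_gt0//=; lra.
  - by rewrite gt_min; apply/orP; left; lra.
  - by rewrite ge_min lexx orbT.
have [s [st ste s01]] : exists s : R, [/\ s != t, `|t - s| < e & 0 <= s <= 1].
  have [t2|t2] := lerP t 2^-1.
    exists (t + e2); split; last by lra.
      by rewrite -subr_eq0 addrC addKr gt_eqF.
    by rewrite opprD addNKr normrN gtr0_norm.
  exists (t - e2); split; last by lra.
    by rewrite -subr_eq0 addrC addKr oppr_eq0 gt_eqF.
  by rewrite opprB addrC subrK gtr0_norm.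
by exists s; apply: (h s).
Qed.

(** Derivatives on [0, 1] can be computed, up to adding a constant to the
    function, from any extension to the line that is differentiable at the
    point. *)
Lemma deriv01_ext (f G : R -> R) (c l t : R) : I01 t ->
  (forall s, I01 s -> f s = G s + c) -> derivable G t 1 -> derive1 G t = l ->
  derivable01 f t /\ deriv01 f t = l.
Proof.
move=> It fG dG Gl.
suff cvgl : diffquot01 f t --> l.
  have PF := within_dnbhs_proper t It.
  by split; [apply/cvg_ex; exists l|exact: cvg_lim].
have : h^-1 *: (G (h + t) - G t) @[h --> 0^'] --> l.
  rewrite -Gl derive1E (_ : (fun h => _) =
      (fun h : R => h^-1 *: ((G \o shift t) (h *: 1) - G t))); first exact: dG.
  by apply/funext => h /=; rewrite [h *: 1]mulr1.
move=> /cvgrPdist_lt cG; apply/cvgrPdist_lt => e e0.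
have [d /= d0 hd] := cG e e0.
exists d => // s /= ts st Is.
rewrite !fG// opprD addrACA subrr addr0.
have := hd (s - t); rewrite /= sub0r normrN subr_eq0 => /(_ _ st) h.
rewrite distrC in ts; move: (h ts); rewrite subrK.
by rewrite [_ *: _]mulrC.
Qed.

Lemma primitive_ae_derivable (u : R -> R) : sq_int01 u ->
  {ae mu, forall t, derivable (primitive u) t 1 /\ derive1 (primitive u) t = u t}.
Proof.
move=> su; apply: FTC1Ny.
  by move=> y; apply: integrable_sub => //; exact: measurable_itv.
by apply: open_integrable_locally; [exact: openT|exact: sq_int01_integrable].
Qed.

(** The restriction of y to [0, 1] may jump at the ends.  There the derivative
    comes from the integral of y itself from -1, a base point to the left of
    [0, 1]. *)
Lemma position_deriv (y : R -> R) (t : R) : continuous y -> I01 t ->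
  derivable01 (primitive (y \_ I01)) t /\ deriv01 (primitive (y \_ I01)) t = y t.
Proof.
move=> cy It; have sy := continuous_sq_int01 _ cy.
move: (It); rewrite /I01/= in_itv/= => /andP[t0 t1].
pose G s := \int[mu]_(r in `[-1, s]) y r.
have iy b : mu.-integrable `[-1, b] (EFin \o y).
  apply: continuous_compact_integrable; first exact: segment_compact.
  exact: continuous_subspaceT.
have [dG Gy] : derivable G t 1 /\ derive1 G t = y t.
  by apply: (@continuous_FTC1_closed R y (-1) t 2) => //; [lra|lra|exact: cy].
apply: (deriv01_ext _ G (- G 0)) => // s.
rewrite /I01/= in_itv/= => /andP[s0 s1].
transitivity (primitive (y \_ I01) s - primitive (y \_ I01) 0).
  by rewrite primitive0// subr0.
rewrite primitiveB// /G.
rewrite (Rintegral_itvB (iy s)) ?bnd_simp ?lerN10//.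
apply: eq_Rintegral => r; rewrite inE/= in_itv/= => /andP[r0 rs].
rewrite patchE mem_set//; rewrite /I01/= in_itv/=.
by apply/andP; split; lra.
Qed.

End differentiation.

(** * Existence *)

Section existence.
Context {R : realType}.
Notation mu := (@lebesgue_measure R).
Notation norm2 := (@seminorm R (R -> R^o) L2ip).

(** Both parts of the assumptions on g enter through the same estimate, applied
    to the difference of two values of the operator and to one value. *)
Lemma superposition_fixpoint (g : R -> R -> R -> R -> R) (delta eta : R)
  (g_cont : {within I01 `*` [set: R * R * R],
     continuous (fun p : R * (R * R * R) => g p.1 p.2.1.1 p.2.1.2 p.2.2)})
  (delta_neq1 : delta != 1) (eta01 : 0 < eta < 1)
  (H1 : exists (K2 K3 l : R) (k1 : R -> R),
    [/\ [/\ 0 <= K2, 0 <= K3 & 0 <= l],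
        Zclass l (fun t => k1 t ^+ 2),
        forall t u1 u2 u3 v1 v2 v3 : R, I01 t ->
          `|g t u1 u2 u3 - g t v1 v2 v3| <=
            k1 t * `|u1 - v1| + K2 * `|u2 - v2| + K3 * `|u3 - v3| &
        (2 * Num.sqrt l + K2) * Cconst delta eta + K3 <= 1])
  (H2 : exists (A2 A3 m : R) (a1 a4 : R -> R),
    [/\ [/\ 0 <= A2, 0 <= A3 & 0 <= m],
        Zclass m (fun t => a1 t ^+ 2),
        L2_01 a4,
        (2 * Num.sqrt m + A2) * Cconst delta eta + A3 < 1 &
        forall t u1 u2 u3 : R, I01 t ->
          `|g t u1 u2 u3| <=
            a1 t * `|u1| + A2 * `|u2| + A3 * `|u3| + a4 t]) :
  exists u, sq_int01 u /\
    {ae mu, forall t, I01 t -> u t = superposition g delta eta u t}.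
Proof.
have [K2 [K3 [l [k1 [[K20 K30 l0] Zk1 lip K1]]]]] := H1.
have [A2 [A3 [m [a1 [a4 [[A20 A30 m0] Za1 La4 q1 grow]]]]]] := H2.
pose N := superposition g delta eta.
have mN v : sq_int01 v -> measurable_fun [set: R] (N v).
  apply: (measurable_superposition _ _ _ g_cont K3) => // t a b c d It.
  by have := lip t a b c a b d It; rewrite !subrr !normr0 !mulr0 !add0r.
have N0 v t : ~ I01 t -> N v t = 0.
  by move=> It; rewrite /N /superposition patchE memNset.
have NE v t : I01 t ->
    N v t = g t (primitive (slope delta eta v \_ I01) t)
      (slope delta eta v t) (v t).
  by move=> It; rewrite /N /superposition patchE mem_set.
have [b [M [sb mM M0 b4]]] := L2_01_borel _ La4.
have growN v : sq_int01 v -> sq_int01 (N v) /\ norm2 (N v) <=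
    ((2 * Num.sqrt m + A2) * Cconst delta eta + A3) * norm2 v +
    norm2 b.
  move=> sv; apply: (majorant_norm_le _ _ delta_neq1 eta01 m A2 A3 a1) => //.
  - exact: mN.
  - exact: N0.
  apply: (lebesgue_null_ae M) => // t nM It; rewrite NE// b4//.
  exact: grow.
have lipN v w : sq_int01 v -> sq_int01 w ->
    norm2 (N v - N w) <= norm2 (v - w).
  move=> sv sw; have sd := sq_int01B _ _ sv sw.
  pose z : R -> R := fun=> 0.
  have sz : sq_int01 z by exact: (ph0 _ _ L2_pre_hilbert).
  have nz : norm2 z = 0 by exact: (seminorm0 L2_pre_hilbert).
  have [||_] := majorant_norm_le _ _ delta_neq1 eta01 l K2 K3 k1 (N v \- N w)
    (v \- w) z l0 Zk1 K20 K30 sd sz (measurable_funB (mN _ sv) (mN _ sw)).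
  - by move=> t It /=; rewrite !N0// subr0.
  - apply/aeW => t It; rewrite /z addr0 /= !NE// position_sub// slope_sub//.
    exact: lip.
  rewrite nz addr0 => /le_trans; apply.
  by rewrite ler_piMl ?seminorm_ge0.
have [u Su Nu] := nonexpansive_fixpoint L2_pre_hilbert L2_complete N
  (fun v sv => (growN v sv).1) _ _ q1 lipN (fun v sv => (growN v sv).2).
have sNu := (growN _ Su).1.
exists u; split=> //.
have sd := sq_int01B _ _ sNu Su; have [md _ _] := sd.
have : (\int[mu]_t `|(((N u \- u) t) ^+ 2)%:E| = 0)%E.
  under eq_integral do rewrite gee0_abs ?lee_fin ?sqr_ge0//.
  by rewrite -norm2_sqr// [norm2 _]Nu expr0n.
move=> /(ae_eq_integral_abs mu measurableT).
have m2 : measurable_fun [set: R] (fun t => ((N u \- u) t ^+ 2)%:E).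
  by apply/measurable_EFinP; exact: measurable_funX.
move=> /(_ m2); apply: lebesgue_aeS => t /(_ I)[] /eqP.
by rewrite sqrf_eq0 subr_eq0 => /eqP.
Qed.

(** Two null sets have to be excluded: u is a fixed point only almost everywhere,
    and x', an indefinite integral of u, has derivative u only almost
    everywhere. *)
Lemma fixpoint_solution (g : R -> R -> R -> R -> R) (delta eta : R) (u : R -> R) :
  delta != 1 -> 0 < eta < 1 -> sq_int01 u ->
  {ae mu, forall t, I01 t -> u t = superposition g delta eta u t} ->
  let x := primitive (slope delta eta u \_ I01) in
    [/\ W22_01 x,
        {ae @completed_lebesgue_measure R, forall t, I01 t ->
          deriv01 (deriv01 x) t
            - g t (x t) (deriv01 x t) (deriv01 (deriv01 x) t) = 0},
        x 0 = 0 &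
        deriv01 x 1 = delta * deriv01 x eta].
Proof.
move=> delta_neq1 eta01 Su fixu.
pose y := slope delta eta u.
have cy : continuous y by exact: continuous_slope.
have sy := continuous_sq_int01 _ cy.
set x := primitive (_ \_ I01).
have dx t : I01 t -> derivable01 x t /\ deriv01 x t = y t by exact: position_deriv.
have ddx : {ae mu, forall t, I01 t ->
    derivable01 (deriv01 x) t /\ deriv01 (deriv01 x) t = u t}.
  apply: lebesgue_aeS (primitive_ae_derivable _ Su) => t [du uE] It.
  apply: (deriv01_ext _ (primitive u)
    ((primitive u 1 - delta * primitive u eta) / (delta - 1))) => // s Is.
  by rewrite (dx s Is).2.
have I1 : I01 (1 : R) by rewrite /I01/= in_itv/= lexx ler01.
have Ie : I01 eta.
  by rewrite /I01/= in_itv/=; have /andP[? ?] := eta01; rewrite !ltW.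
split.
- split.
  + exact: primitive_absolutely_continuous.
  + by move=> t /dx[].
  + move=> e e0; have [d d0 hd] := primitive_absolutely_continuous _ Su e e0.
    exists d => // n a c ac tI small; apply: le_lt_trans (hd n a c ac tI small).
    rewrite le_eqVlt; apply/orP; left; apply/eqP; apply: eq_bigr => i _.
    have [a0 aLc c1] := ac i.
    have Ia : I01 (a i) by rewrite /I01/= in_itv/= a0 (le_trans aLc).
    have Ic : I01 (c i) by rewrite /I01/= in_itv/= c1 (le_trans a0).
    by rewrite (dx _ Ia).2 (dx _ Ic).2 slopeB.
  + by apply: ae_completed; apply: lebesgue_aeS ddx => t h /h[].
  + by apply: (sq_int01_L2_01 u) => //; apply: lebesgue_aeS ddx => t h /h[].
- apply: ae_completed.
  apply: lebesgue_aeS (lebesgue_aeI _ _ ddx fixu) => t [h fu] It.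
  have [_ ->] := h It; rewrite (dx t It).2; apply/eqP; rewrite subr_eq0; apply/eqP.
  by rewrite {1}(fu It) /superposition patchE mem_set.
- exact: primitive0.
- by rewrite !(dx _ _).2// /y slope_boundary.
Qed.

End existence.

Theorem theorem3p2 (R : realType) (g : R -> R -> R -> R -> R) (delta eta : R)
  (g_cont : {within I01 `*` [set: R * R * R],
     continuous (fun p : R * (R * R * R) => g p.1 p.2.1.1 p.2.1.2 p.2.2)})
  (delta_neq1 : delta != 1) (eta01 : 0 < eta < 1)
  (H1 : exists (K2 K3 l : R) (k1 : R -> R),
    [/\ [/\ 0 <= K2, 0 <= K3 & 0 <= l],
        Zclass l (fun t => k1 t ^+ 2),
        forall t u1 u2 u3 v1 v2 v3 : R, I01 t ->
          `|g t u1 u2 u3 - g t v1 v2 v3| <=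
            k1 t * `|u1 - v1| + K2 * `|u2 - v2| + K3 * `|u3 - v3| &
        (2 * Num.sqrt l + K2) * Cconst delta eta + K3 <= 1])
  (H2 : exists (A2 A3 m : R) (a1 a4 : R -> R),
    [/\ [/\ 0 <= A2, 0 <= A3 & 0 <= m],
        Zclass m (fun t => a1 t ^+ 2),
        L2_01 a4,
        (2 * Num.sqrt m + A2) * Cconst delta eta + A3 < 1 &
        forall t u1 u2 u3 : R, I01 t ->
          `|g t u1 u2 u3| <=
            a1 t * `|u1| + A2 * `|u2| + A3 * `|u3| + a4 t]) :
  exists x : R -> R,
    [/\ W22_01 x,
        {ae @completed_lebesgue_measure R, forall t, I01 t ->
          deriv01 (deriv01 x) t
            - g t (x t) (deriv01 x t) (deriv01 (deriv01 x) t) = 0},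
        x 0 = 0 &
        deriv01 x 1 = delta * deriv01 x eta].
Proof.
have [u [su fixu]] := superposition_fixpoint _ _ _ g_cont delta_neq1 eta01 H1 H2.
by eexists; exact: fixpoint_solution delta_neq1 eta01 su fixu.
Qed.
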